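(* Determinants of interval tridiagonal H-matrices are computable in polynomial time. That is, there is a polynomial time algorithm which, given an interval tridiagonal matrix $\mathbf{A}=[\underline{A},\overline{A}]$ with rational bounds that is an interval H-matrix, computes the exact bounds $\min\{\det(A) : A\in\mathbf{A}\}$ and $\max\{\det(A) : A\in\mathbf{A}\}$ of its interval determinant $\det(\mathbf{A})=\{\det(A) : A\in\mathbf{A}\}$.
   Context: An interval matrix is a set $\mathbf{A}=[\underline{A},\overline{A}]=\{A\in\mathbb{R}^{n\times n} : \underline{A}\le A\le\overline{A}\}$, where $\underline{A}\le\overline{A}$ are real $n\times n$ matrices and inequalities are entrywise. It is tridiagonal if $\underline{A}_{ij}=\overline{A}_{ij}=0$ whenever $|i-j|>1$; the entries on the three diagonals vary independently in their intervals (no symmetry is assumed). A real square matrix $A$ is an H-matrix if its comparison matrix $\langle A\rangle$, defined by $\langle A\rangle_{ii}=|A_{ii}|$ and $\langle A\rangle_{ij}=-|A_{ij}|$ for $i\ne j$, is a nonsingular M-matrix (i.e. it has nonpositive off-diagonal entries, is nonsingular, and has entrywise nonnegative inverse). An interval matrix $\mathbf{A}$ is an interval H-matrix if every $A\in\mathbf{A}$ is an H-matrix. Polynomial time is with respect to the bit length of the rational input (the dimension $n$ is part of the input). *)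

(* Defs.v *)
From HB Require Import structures.
From mathcomp Require Import all_boot all_order all_algebra.
From mathcomp Require Import classical_sets reals.

Set Implicit Arguments.
Unset Strict Implicit.
Unset Printing Implicit Defensive.

Import Order.TTheory GRing.Theory Num.Theory.
Local Open Scope ring_scope.

(* Algorithms are programs of the random access machine of Cook and Reckhow
   (Time bounded random access machines, JCSS 7, 1973) under the logarithmic
   cost criterion, with a multiplication instruction charged the schoolbook
   cost. It is polynomially equivalent to the multitape Turing machine. *)

(* bitlen 0 = 1 since trunc_log 2 0 = 0. *)
Definition bitlen (z : int) : nat := (trunc_log 2 `|z|%N).+1.

Definition bitsize (w : seq int) : nat := (\sum_(z <- w) bitlen z)%N.

(* Direct register addresses and constants occur in the program and, as in
   Cook and Reckhow, are not charged; indirect addresses are. *)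
Inductive instr : Type :=
| Const of nat & int
| Add of nat & nat & nat
| Sub of nat & nat & nat
| Mul of nat & nat & nat
| Fetch of nat & nat
| Store of nat & nat
| Jump of nat & nat
| Read of nat
| Print of nat.

Record config : Type := Config {
  pc : nat;
  reg : nat -> int;
  inp : seq int;
  out : seq int
}.

Definition start (w : seq int) : config := Config 0 (fun=> 0) w [::].

(* None is a crash: an indirect access to a negative address, or reading past
   the end of the input. A crashed program does not [run]. *)
Definition exec (ins : instr) (c : config) : option (nat * config) :=
  let: Config p X u o := c in
  let set i v := Config p.+1 [eta X with i |-> v] u o in
  match ins with
  | Const i z => Some (1%N, set i z)
  | Add i j k => Some ((bitlen (X j) + bitlen (X k))%N, set i (X j + X k))
  | Sub i j k => Some ((bitlen (X j) + bitlen (X k))%N, set i (X j - X k))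
  | Mul i j k => Some ((bitlen (X j) * bitlen (X k))%N, set i (X j * X k))
  | Fetch i j =>
      if X j is Posz a then Some ((bitlen (X j) + bitlen (X a))%N, set i (X a))
      else None
  | Store i j =>
      if X i is Posz a then Some ((bitlen (X i) + bitlen (X j))%N, set a (X j))
      else None
  | Jump m j =>
      Some (bitlen (X j), Config (if 0 < X j then m else p.+1) X u o)
  | Read i =>
      if u is z :: u' then
        Some (bitlen z, Config p.+1 [eta X with i |-> z] u' o)
      else None
  | Print i => Some (bitlen (X i), Config p.+1 X u (rcons o (X i)))
  end.

Inductive run (P : seq instr) : config -> nat -> seq int -> Prop :=
| run_halt c of onth P (pc c) = None : run P c 0 (out c)
| run_step c ins k c' t o of
    onth P (pc c) = Some ins & exec ins c = Some (k, c') & run P c' t o :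
    run P c (k + t) o.

(* A promise problem: nothing is required of P outside [valid]. *)
Definition polytime_solvable (I : Type) (code : I -> seq int)
    (valid : I -> Prop) (solution : I -> seq int -> Prop) : Prop :=
  exists (P : seq instr) (c d : nat), forall x : I, valid x ->
    exists (t : nat) (o : seq int),
      [/\ run P (start (code x)) t o,
          (t <= c * bitsize (code x) ^ d)%N
        & solution x o].

Section IntervalMatrices.
Variables (R : realType) (n : nat).
Implicit Types A B : 'M[R]_n.

Definition lemx A B : Prop := forall i j, A i j <= B i j.

Definition interval_mx Alo Ahi : set 'M[R]_n :=
  [set A | lemx Alo A /\ lemx A Ahi]%classic.

Definition tridiagonal A : Prop :=
  forall i j : 'I_n, 1 < `|i%:Z - j%:Z| -> A i j = 0.

Definition interval_tridiagonal Alo Ahi : Prop :=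
  tridiagonal Alo /\ tridiagonal Ahi.

Definition comparison_mx A : 'M[R]_n :=
  \matrix_(i, j) if i == j then `|A i j| else - `|A i j|.

Definition nonsingular_Mmatrix A : Prop :=
  [/\ forall i j : 'I_n, i != j -> A i j <= 0,
      A \in unitmx
    & forall i j : 'I_n, 0 <= invmx A i j].

Definition Hmatrix A : Prop := nonsingular_Mmatrix (comparison_mx A).

Definition interval_Hmatrix Alo Ahi : Prop :=
  forall A, interval_mx Alo Ahi A -> Hmatrix A.

Definition interval_det Alo Ahi : set R :=
  [set \det A | A in interval_mx Alo Ahi]%classic.

End IntervalMatrices.

Definition is_min (R : realType) (S : set R) (m : R) : Prop :=
  S m /\ lbound S m.

Definition is_max (R : realType) (S : set R) (m : R) : Prop :=
  S m /\ ubound S m.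

(* Rationals are written as fractions, not necessarily in lowest terms, both
   in the input and in the output. *)
Record qfrac : Type := QFrac { qnum : int; qden : int; qden_gt0 : 0 < qden }.

Definition qfrac_code (f : qfrac) : seq int := [:: qnum f; qden f].

Definition qfrac_val (R : realType) (f : qfrac) : R := (qnum f)%:~R / (qden f)%:~R.

Record rat_interval_mx : Type := RatIntervalMx {
  dim : nat;
  lower : 'M[qfrac]_dim;
  upper : 'M[qfrac]_dim
}.

Definition rat_interval_mx_code (M : rat_interval_mx) : seq int :=
  (dim M)%:Z ::
  flatten [seq qfrac_code (lower M i j) ++ qfrac_code (upper M i j)
             | i <- enum 'I_(dim M), j <- enum 'I_(dim M)].

Definition lower_mx (R : realType) (M : rat_interval_mx) : 'M[R]_(dim M) :=
  map_mx (@qfrac_val R) (lower M).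

Definition upper_mx (R : realType) (M : rat_interval_mx) : 'M[R]_(dim M) :=
  map_mx (@qfrac_val R) (upper M).

Definition tridiagonal_Hmatrix_instance (R : realType) (M : rat_interval_mx) :
    Prop :=
  [/\ lemx (lower_mx R M) (upper_mx R M),
      interval_tridiagonal (lower_mx R M) (upper_mx R M)
    & interval_Hmatrix (lower_mx R M) (upper_mx R M)].

Definition det_bounds (R : realType) (M : rat_interval_mx) (o : seq int) :
    Prop :=
  exists fmin fmax : qfrac,
    [/\ o = qfrac_code fmin ++ qfrac_code fmax,
        is_min (interval_det (lower_mx R M) (upper_mx R M)) (qfrac_val R fmin)
      & is_max (interval_det (lower_mx R M) (upper_mx R M)) (qfrac_val R fmax)].

(* Main.v *)
Require Import Defs.
From mathcomp Require Import all_boot all_order all_algebra.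
From mathcomp Require Import boolp classical_sets reals.
From mathcomp Require Import zify ring lra.

(** Multiply row k of a member A of the interval by the sign g_k of its diagonal
    entry. An H-matrix has no zero on its diagonal, so g_k is the same for all
    members. The leading minors of the scaled matrix satisfy
    D_(k+1) = a_k D_k - p_k D_(k-1), where a_k is the scaled diagonal entry and
    p_k the product of the two scaled entries that couple the indices k-1 and k
    ([det_continuant]).

    A tridiagonal H-matrix with comparison matrix C has a positive vector u with
    C u positive ([Hmatrix_weights]), and this keeps the recursion positive
    whenever it is restarted with (D_k, D_(k-1)) = (1, 0) ([continuant_gt0]). The
    value so obtained at the end is the factor by which a change of D_k alone
    changes the determinant; hence replacing the rows of A one at a time
    by rows with larger a_k and smaller p_k can only increase the scaled
    determinant ([continuant_le]). The entries being independent, a_k and p_k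
    reach their extrema simultaneously, a_k at an endpoint and p_k at one of the
    four products of endpoints, so the largest scaled determinant is the
    continuant of the largest a_k and the smallest p_k, and the smallest one that
    of the smallest a_k and the largest p_k ([sdet_extrema]). The product of the
    g_k turns the scaled determinant back into the determinant, exchanging the
    two bounds when it is -1.

    In row-major order the entries that can be nonzero come as
    A_00, A_01, A_10, A_11, A_12, A_21, ..., with n - 2 entries to skip after each
    superdiagonal one, so the two recursions can be run while the input is being
    read, in a bounded number of registers. All values are kept over one common
    denominator that is never reduced. One row multiplies their bound by at most
    2^(7 N) for an input of N bits ([fits_row]), so the registers never exceed
    O(N^2) bits ([bitlen_bound]); a row takes O(n) instructions of cost
    O(N^4), which gives the bound O(N^6) ([det_program_polynomial]).

    The program is written in a small while-language that is compiled to the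
    machine. The relation [reaches] is a Hoare-style judgement on commands with
    an upper bound on the cost; straight-line code is run symbolically on lists
    of registers ([eval]), its cost being bounded by the crude remark that an
    operation at most doubles the bit length of the longest register
    ([reaches_block]). *)

Set Implicit Arguments.
Unset Strict Implicit.
Unset Printing Implicit Defensive.
Import Order.TTheory GRing.Theory Num.Theory.
Local Open Scope ring_scope.

(** * Continuants *)

Section Continuant.
Variable R : realFieldType.
Implicit Types (a b c p u : nat -> R) (x y : R).

(** Runs [m] steps of the recursion from row [k], where [x] and [y] stand for the
    minors D_k and D_(k-1); with [x = 1] and [y = 0] it is the continuant of the
    rows [k, ..., k + m - 1]. *)
Fixpoint continuant a p k m x y : R :=
  if m is m'.+1 then continuant a p k.+1 m' (a k * x - p k * y) x else x.

Lemma continuant_linear a p k m d x y x' y' :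
  continuant a p k m (x + d * x') (y + d * y')
  = continuant a p k m x y + d * continuant a p k m x' y'.
Proof.
elim: m k x y x' y' => //= m IH k x y x' y'.
by rewrite -IH; congr continuant; ring.
Qed.

(** Generalized diagonal dominance of the tridiagonal matrix with diagonal [a],
    superdiagonal [b] and subdiagonal [c], the entry of row [k] left of the
    diagonal being [c k]. The last two conditions say that nothing sticks out of
    the matrix on the left of row 0 or on the right of row [n - 1]. *)
Definition dominant n a b c : Prop := exists2 u : nat -> R,
  (forall k, (k < n)%N -> 0 < u k) /\
    (forall k, (k < n)%N -> `|c k| * u k.-1 + `|b k| * u k.+1 < a k * u k)
  & c 0%N = 0 /\ b n.-1 = 0.

Definition link b c : nat -> R := fun k => c k * b k.-1.

(** The invariant that dominance propagates: D_k is positive and at least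
    |b_(k-1)| u_k / u_(k-1) times D_(k-1), which bounds the loss p_k D_(k-1) of the
    next step by |c_k| u_(k-1) / u_k times D_k. *)
Definition steady u b k x y : Prop :=
  [/\ 0 < x, 0 <= y & (0 < k)%N -> `|b k.-1| * u k * y <= u k.-1 * x].

Lemma steady_step n a b c u k x y :
  (forall k, (k < n)%N -> 0 < u k) ->
  (forall k, (k < n)%N -> `|c k| * u k.-1 + `|b k| * u k.+1 < a k * u k) ->
  c 0%N = 0 -> b n.-1 = 0 -> (k < n)%N -> steady u b k x y ->
  steady u b k.+1 (a k * x - link b c k * y) x.
Proof.
move=> u0 dom c0 bn kn [x0 y0 xy].
have uk := u0 k kn.
have bu : 0 <= `|b k| * u k.+1.
  have [kn'|] := ltnP k.+1 n; first by rewrite mulr_ge0 // ltW // u0.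
  by move=> nk; rewrite (_ : k = n.-1) ?bn ?normr0 ?mul0r //; lia.
have cy : link b c k * y * u k <= `|c k| * u k.-1 * x.
  rewrite /link; case: k kn xy uk {bu} => [|k] kn xy uk.
    by rewrite c0 !(mul0r, normr0).
  apply: le_trans (_ : `|c k.+1| * (`|b k| * u k.+1 * y) <= _).
    have -> : c k.+1 * b k.+1.-1 * y * u k.+1 = (c k.+1 * b k) * (u k.+1 * y).
      by rewrite /=; ring.
    rewrite (_ : _ * (_ * _ * y) = `|c k.+1 * b k| * (u k.+1 * y)); last first.
      by rewrite normrM; ring.
    rewrite ler_wpM2r ?ler_norm //.
    by rewrite mulr_ge0 // ltW.
  by rewrite -[leRHS]mulrA ler_wpM2l //; apply: xy.
have main : `|b k| * u k.+1 * x < u k * (a k * x - link b c k * y).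
  have := dom k kn; rewrite -(ltr_pM2r x0) mulrDl; move: cy; lra.
split; [|exact: ltW|by move=> _ /=; apply: ltW].
by rewrite -(pmulr_rgt0 _ uk); apply: le_lt_trans main; rewrite mulr_ge0 // ltW.
Qed.

(** The start (1, 0) is steady at every row, because its second component
    vanishes. *)
Lemma continuant_gt0 n a b c k m : dominant n a b c -> (k + m = n)%N ->
  0 < continuant a (link b c) k m 1 0.
Proof.
case=> u [u0 dom] [c0 bn].
suff H x y : (k + m = n)%N -> steady u b k x y ->
    0 < continuant a (link b c) k m x y.
  move=> kmn; case: m kmn H => [|m] kmn H; first by [].
  apply: H => //; split => // k0; rewrite mulr0 mulr1 ltW // u0 //; lia.
elim: m k x y => [|m IH] k x y kmn st; first by case: st.
rewrite /=; apply: IH; first by lia.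
by apply: (steady_step u0 dom) => //; lia.
Qed.

(** Replace the rows of the first matrix by those of the second one from the top.
    One replacement moves the first component of the state by [d >= 0] and leaves
    the second one alone, so by linearity it adds [d] times a continuant of the
    remaining rows of the first matrix, which is positive. *)
Lemma continuant_le n a b c a' b' c' :
  dominant n a b c -> dominant n a' b' c' ->
  (forall k, (k < n)%N -> a k <= a' k) ->
  (forall k, (k < n)%N -> link b' c' k <= link b c k) ->
  continuant a (link b c) 0 n 1 0 <= continuant a' (link b' c') 0 n 1 0.
Proof.
move=> dom [u [u0 dom'] [c0 bn]] aa' pp'.
suff H m k x y : (k + m = n)%N -> steady u b' k x y ->
    continuant a (link b c) k m x y <= continuant a' (link b' c') k m x y.
  by apply: H.
elim: m k x y => [|m IH] k x y kmn st //=.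
have kn : (k < n)%N by lia.
(* The middle term takes row k from the second matrix and the rest from the first. *)
apply: le_trans (_ : continuant a (link b c) k.+1 m
                       (a' k * x - link b' c' k * y) x <= _); last first.
  by apply: IH; [lia | apply: (steady_step u0 dom')].
have [x0 y0 _] := st.
set d := a' k * x - link b' c' k * y - (a k * x - link b c k * y).
have -> : continuant a (link b c) k.+1 m (a' k * x - link b' c' k * y) x
    = continuant a (link b c) k.+1 m (a k * x - link b c k * y) x
      + d * continuant a (link b c) k.+1 m 1 0.
  by rewrite -continuant_linear mulr0 addr0; congr continuant; rewrite /d; ring.
rewrite lerDl mulr_ge0 //.
  rewrite /d (_ : _ - _ = (a' k - a k) * x + (link b c k - link b' c' k) * y).
    by rewrite addr_ge0 // mulr_ge0 ?subr_ge0 ?aa' ?pp' // ltW.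
  by ring.
by apply/ltW/(continuant_gt0 dom); lia.
Qed.

End Continuant.

(** * Tridiagonal determinants *)

Section Determinant.
Variable R : comPzRingType.
Variable f : nat -> nat -> R.
Hypothesis f_tri : forall i j, (i.+1 < j)%N || (j.+1 < i)%N -> f i j = 0.

Definition leading k : 'M[R]_k := \matrix_(i, j) f i j.

(** Expand along the last row, then expand the minor that comes with the
    subdiagonal entry along its last column, where only the superdiagonal entry
    survives. *)
Lemma det_leading_rec k : \det (leading k.+2)
  = f k.+1 k.+1 * \det (leading k.+1) - f k.+1 k * f k k.+1 * \det (leading k).
Proof.
rewrite (expand_det_row _ ord_max) !big_ord_recr /= big1 => [|j _]; last first.
  by rewrite mxE f_tri ?mul0r //= ltnS ltn_ord orbT.
rewrite add0r addrC !mxE /=; congr (_ + _).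
  rewrite /cofactor addnn -signr_odd odd_double mul1r; congr (_ * \det _).
  by apply/matrixP => i j; rewrite !mxE !lift_max.
rewrite -[in RHS]mulrA -mulrN /cofactor /= addSn addnn -signr_odd /=.
rewrite odd_double /= expr1 mulN1r; congr (_ * - _).
rewrite (expand_det_col _ ord_max) big_ord_recr /= big1 => [|i _].
  rewrite add0r !mxE /= /bump ltnn leqnn /= add0n add1n; congr (_ * _).
  rewrite /cofactor addnn -signr_odd odd_double mul1r; congr (\det _).
  apply/matrixP => i j; rewrite !mxE !lift_max; congr f.
  by have := ltn_ord j; rewrite /= /bump; lia.
rewrite !mxE f_tri ?mul0r // lift_max /= /bump; have := ltn_ord i; lia.
Qed.

End Determinant.

Lemma det_continuant (R : realFieldType) (f : nat -> nat -> R) b c n :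
  (forall i j, (i.+1 < j)%N || (j.+1 < i)%N -> f i j = 0) ->
  (forall k, (k.+1 < n)%N -> b k * c k.+1 = f k.+1 k * f k k.+1) ->
  \det (leading f n) = continuant (fun k => f k k) (link b c) 0 n 1 0.
Proof.
move=> f_tri bc.
have H m k : (k + m = n)%N -> continuant (fun k => f k k) (link b c) k m
    (\det (leading f k)) (if k is k'.+1 then \det (leading f k') else 0)
    = \det (leading f n).
  elim: m k => [|m IH] k; first by rewrite addn0 => ->.
  rewrite addnS -addSn => kmn /=; rewrite -(IH k.+1 kmn); congr continuant.
  case: k kmn => [|k] kmn; last first.
    by rewrite det_leading_rec // /link [c _ * _]mulrC /= bc // -kmn; lia.
  by rewrite det_mx00 mulr0 subr0 mulr1 det_mx11 mxE.
by rewrite -(H n 0%N) // det_mx00.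
Qed.

Lemma eq_continuant (R : realFieldType) (a a' p p' : nat -> R) k m x y :
  (forall i, (i < k + m)%N -> a i = a' i /\ p i = p' i) ->
  continuant a p k m x y = continuant a' p' k m x y.
Proof.
elim: m k x y => //= m IH k x y e; rewrite -addSnnS in e.
by have [-> ->] := e k (leq_addr m k.+1); apply: IH.
Qed.

Definition min4 (T : orderType ring_display) (x y z t : T) : T :=
  Order.min (Order.min (Order.min x y) z) t.
Definition max4 (T : orderType ring_display) (x y z t : T) : T :=
  Order.max (Order.max (Order.max x y) z) t.

Section Between.
Variable R : realFieldType.
Implicit Types x y : R.

(** Means that [x] lies between [x1] and [x2] in whichever order these come, which
    is what remains of an interval after multiplication by a number of unknown
    sign. *)
Definition between x1 x2 x : bool := 0 <= (x - x1) * (x2 - x).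

Lemma betweenZ x1 x2 x y : between x1 x2 x -> between (y * x1) (y * x2) (y * x).
Proof. by rewrite /between -!mulrBr mulrACA => H; rewrite mulr_ge0 // -expr2 sqr_ge0. Qed.

Lemma between_bounds x1 x2 x : between x1 x2 x ->
  Num.min x1 x2 <= x /\ x <= Num.max x1 x2.
Proof. by rewrite /between; case: (leP x1 x2) => x12 H; split; nra. Qed.

(** A product is affine in each factor, so its extrema over a box are at
    corners. *)
Lemma between_mul_bounds x1 x2 x y1 y2 y : between x1 x2 x -> between y1 y2 y ->
  min4 (x1 * y1) (x1 * y2) (x2 * y1) (x2 * y2) <= x * y
  /\ x * y <= max4 (x1 * y1) (x1 * y2) (x2 * y1) (x2 * y2).
Proof.
move=> hx hy; have := between_bounds (betweenZ y hx).
have [l1 r1] := between_bounds (betweenZ x1 hy).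
have [l2 r2] := between_bounds (betweenZ x2 hy).
rewrite /min4 /max4 ![y * _]mulrC => -[l r]; split.
  apply: le_trans l; rewrite le_min; apply/andP; split.
    by apply: le_trans l1; rewrite 2!ge_min lexx.
  by apply: le_trans l2; rewrite le_min; apply/andP; split; rewrite !ge_min lexx ?orbT.
apply: (le_trans r); rewrite ge_max; apply/andP; split.
  by apply: (le_trans r1); rewrite 2!le_max lexx.
by apply: (le_trans r2); rewrite ge_max; apply/andP; split; rewrite !le_max lexx ?orbT.
Qed.

End Between.

(** * Interval matrices *)

Lemma gt1_dist (i j : nat) :
  (1 < `|i%:Z - j%:Z|) = (i.+1 < j)%N || (j.+1 < i)%N.
Proof. lia. Qed.

Section Interval.
Variables (R : realType) (n : nat).
Implicit Types (A : 'M[R]_n).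

(** Indexing by natural numbers, with zeros outside the matrix, lets the first and
    the last row be treated like the others. *)
Definition entry A (i j : nat) : R :=
  if (insub i, insub j) is (Some i', Some j') then A i' j' else 0.

Lemma entryE A (i j : 'I_n) : entry A i j = A i j.
Proof. by rewrite /entry !valK. Qed.

Lemma entry_ltn A i j (lt_in : (i < n)%N) (lt_jn : (j < n)%N) :
  entry A i j = A (Ordinal lt_in) (Ordinal lt_jn).
Proof. exact: entryE (Ordinal lt_in) (Ordinal lt_jn). Qed.

Lemma entry_out A i j : (n <= i)%N || (n <= j)%N -> entry A i j = 0.
Proof.
rewrite /entry; case: insubP => // i' _ <-; case: insubP => // j' _ <-.
by case/orP; rewrite leqNgt ltn_ord.
Qed.

Lemma entry_tridiagonal A : tridiagonal A ->
  forall i j, (i.+1 < j)%N || (j.+1 < i)%N -> entry A i j = 0.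
Proof.
move=> At i j ij; rewrite /entry; case: insubP => // i' _ ei.
by case: insubP => // j' _ ej; apply: At; rewrite gt1_dist ei ej.
Qed.

(** The vector [u = C^-1 1], for the comparison matrix [C], is nonnegative since
    [C^-1] is, and [C u = 1]; a zero component would make a row of [C u]
    nonpositive. *)
Lemma Hmatrix_weights A : Hmatrix A -> exists2 u : 'I_n -> R,
  forall i, 0 < u i & forall i, \sum_(j | j != i) `|A i j| * u j < `|A i i| * u i.
Proof.
case=> _ unitC inv_ge0.
pose v : 'cV[R]_n := invmx (comparison_mx A) *m const_mx 1.
have v_ge0 i : 0 <= v i 0.
  by rewrite mxE sumr_ge0 // => j _; rewrite mxE mulr1.
have e i : (comparison_mx A *m v) i 0 = 1 by rewrite mulmxA mulmxV // mul1mx mxE.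
move: v v_ge0 e => v v_ge0 e.
have dom i : \sum_(j | j != i) `|A i j| * v j 0 < `|A i i| * v i 0.
  have := e i; rewrite mxE (bigD1 i) //= mxE eqxx => ei; rewrite -subr_gt0 -sumrN.
  suff -> : \sum_(j | j != i) - (`|A i j| * v j 0)
      = \sum_(j | j != i) comparison_mx A i j * v j 0 by rewrite ei.
  by apply: eq_bigr => j ji; rewrite mxE eq_sym (negbTE ji) mulNr.
exists (v^~ 0) => // i; rewrite lt_neqAle v_ge0 andbT; apply/eqP => vi.
have := dom i; rewrite -vi mulr0 ltNge sumr_ge0 // => j _.
by rewrite mulr_ge0.
Qed.

Lemma Hmatrix_diag A i : Hmatrix A -> A i i != 0.
Proof.
case/Hmatrix_weights=> u u0 /(_ i); apply: contraTneq => ->.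
rewrite normr0 mul0r -leNgt sumr_ge0 // => j _.
by rewrite mulr_ge0 // ltW.
Qed.

Variable g : nat -> R.
Hypothesis norm_g : forall k, (k < n)%N -> `|g k| = 1.

Definition diag_seq A k := g k * entry A k k.
Definition super_seq A k := g k * entry A k k.+1.
Definition sub_seq A k := if k is k'.+1 then g k * entry A k k' else 0.

(** Scaling a row by a sign does not change the absolute values in it, so the
    weights of [A] serve for the scaled matrix; only the neighbours of the diagonal
    are kept from the row sums. *)
Lemma Hmatrix_dominant A : Hmatrix A ->
  (forall k, (k < n)%N -> 0 < diag_seq A k) ->
  dominant n (diag_seq A) (super_seq A) (sub_seq A).
Proof.
case/Hmatrix_weights=> u u0 dom dg.
pose v k := if insub k is Some i then u i else 0.
have vE k (kn : (k < n)%N) : v k = u (Ordinal kn) by rewrite /v insubT.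
exists v; last first.
  split=> //; rewrite /super_seq entry_out ?mulr0 //.
  by case: (n) => [|m] //=; rewrite leqnn orbT.
split=> k kn; first by rewrite vE.
have gk := norm_g kn.
pose i := Ordinal kn; pose F j := `|A i j| * u j.
have F0 j : 0 <= F j by rewrite mulr_ge0 // ltW.
have -> : diag_seq A k * v k = `|A i i| * u i.
  by rewrite vE -{1}(gtr0_norm (dg k kn)) normrM gk mul1r (entry_ltn _ kn kn).
apply: le_lt_trans (dom i).
have sup : `|super_seq A k| * v k.+1
    = if insub k.+1 is Some j then F j else 0.
  rewrite /super_seq normrM gk mul1r /v; case: insubP => [j _ ej|]; last by rewrite mulr0.
  by have := entryE A i j; rewrite [X in entry A _ X]ej => ->.
have sub : `|sub_seq A k| * v k.-1 = if k is k'.+1 then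
    if insub k' is Some j then F j else 0 else 0.
  rewrite /sub_seq {sup}; case: k kn gk @i @F F0 => [|k] kn gk i F F0 /=.
    by rewrite normr0 mul0r.
  rewrite normrM gk mul1r /v; case: insubP => [j _ ej|]; last by rewrite mulr0.
  by have := entryE A i j; rewrite [X in entry A _ X]ej => ->.
rewrite addrC sup sub.
have S0 : 0 <= \sum_(j | j != i) F j by apply: sumr_ge0.
have le1 j : j != i -> F j <= \sum_(j | j != i) F j.
  by move=> ji; rewrite (bigD1 j) //= lerDl sumr_ge0.
have le2 j1 j2 : j1 != i -> j2 != i -> j2 != j1 -> F j1 + F j2 <= \sum_(j | j != i) F j.
  by move=> j1i j2i j21; rewrite (bigD1 j1) //= (bigD1 j2) ?j2i //= addrA lerDl sumr_ge0.
have neq (j j' : 'I_n) : (j != j') = (val j != val j') by [].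
case: insubP => [j1 _ e1|_]; last first.
  rewrite add0r; move: (erefl k); case: {-1}k => [|k'] ek; first by [].
  case: insubP => [j2 _ e2|_]; last by [].
  by apply: le1; rewrite neq e2 /=; lia.
have j1i : j1 != i by rewrite neq e1 /=; lia.
move: (erefl k); case: {-1}k => [|k'] ek; first by rewrite addr0 le1.
case: insubP => [j2 _ e2|_]; last by rewrite addr0 le1.
by apply: le2 => //; rewrite neq e2 ?e1 /=; lia.
Qed.

Lemma det_scaled A : tridiagonal A ->
  (\prod_(k < n) g k) * \det A
  = continuant (diag_seq A) (link (super_seq A) (sub_seq A)) 0 n 1 0.
Proof.
move=> At; rewrite -(@det_continuant _ (fun i j => g i * entry A i j)).
- have -> : leading (fun i j => g i * entry A i j) n
      = diag_mx (\row_(i < n) g i) *m A.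
    by apply/matrixP => i j; rewrite mul_diag_mx !mxE entryE.
  by rewrite det_mulmx det_diag; congr (_ * _); apply: eq_bigr => k _; rewrite mxE.
- by move=> i j ij; rewrite entry_tridiagonal ?mulr0.
- by move=> k _; rewrite mulrC.
Qed.

Variables lo hi : 'M[R]_n.
Hypothesis lo_hi_tri : interval_tridiagonal lo hi.

Lemma interval_tridiag A : interval_mx lo hi A -> tridiagonal A.
Proof.
case: lo_hi_tri => lo_tri hi_tri [loA Ahi] i j ij.
by apply/le_anti; rewrite -{1}(hi_tri i j ij) -(lo_tri i j ij) Ahi loA.
Qed.

Lemma entry_interval A i j : interval_mx lo hi A ->
  entry lo i j <= entry A i j <= entry hi i j.
Proof.
case=> loA Ahi; rewrite /entry; case: insubP => [i' _ _|_]; last by rewrite lexx.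
by case: insubP => [j' _ _|_]; rewrite ?lexx // loA Ahi.
Qed.

Lemma interval_of_bands (x y z : nat -> R) :
  (forall k, (k < n)%N -> entry lo k k <= x k <= entry hi k k) ->
  (forall k, (k.+1 < n)%N -> entry lo k k.+1 <= y k <= entry hi k k.+1) ->
  (forall k, (k.+1 < n)%N -> entry lo k.+1 k <= z k <= entry hi k.+1 k) ->
  exists2 A, interval_mx lo hi A &
    (forall k, (k < n)%N -> entry A k k = x k) /\
    (forall k, (k.+1 < n)%N -> entry A k k.+1 = y k /\ entry A k.+1 k = z k).
Proof.
move=> xP yP zP.
pose A : 'M[R]_n := \matrix_(i, j) if i == j then x i else
  if j == i.+1 :> nat then y i else if i == j.+1 :> nat then z j else 0.
have AP i j : lo i j <= A i j <= hi i j.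
  rewrite mxE -!entryE; case: eqP => [<-|/eqP ij]; first exact: xP.
  case: eqP => [e|/eqP ij1]; first by rewrite e yP // -e.
  case: eqP => [e|/eqP ij2]; first by rewrite e zP // -e.
  have far : 1 < `|i%:Z - j%:Z|.
    by move: ij ij1 ij2; rewrite gt1_dist -val_eqE /=; lia.
  by rewrite !entryE; case: lo_hi_tri => -> // ->; rewrite ?lexx.
exists A; first by split=> i j; case/andP: (AP i j).
split=> k kn; first by rewrite entry_ltn mxE eqxx.
have kn' := ltnW kn.
rewrite (entry_ltn _ kn' kn) (entry_ltn _ kn kn') !mxE -!val_eqE /= !eqxx.
have [-> -> ->] : [/\ (k == k.+1) = false, (k.+1 == k) = false & (k == k.+2) = false].
  by split; apply/eqP; lia.
by [].
Qed.

Hypothesis lo_hi_H : interval_Hmatrix lo hi.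
Hypothesis diag_gt0 : forall A k,
  interval_mx lo hi A -> (k < n)%N -> 0 < diag_seq A k.

(** The coefficients of a recursion come from a member of the interval as soon as
    they are realized locally: each entry on the three diagonals enters exactly
    one coefficient. *)
Definition attained (a p : nat -> R) : Prop :=
  [/\ forall k, (k < n)%N ->
        exists2 x, entry lo k k <= x <= entry hi k k & a k = g k * x,
      p 0%N = 0
    & forall k, (k.+1 < n)%N -> exists y z,
        [/\ entry lo k k.+1 <= y <= entry hi k k.+1,
            entry lo k.+1 k <= z <= entry hi k.+1 k
          & p k.+1 = (g k * y) * (g k.+1 * z)]].

Let link_seq A := link (super_seq A) (sub_seq A).

Lemma attainedP a p : attained a p -> exists2 A, interval_mx lo hi A &
  forall k, (k < n)%N -> a k = diag_seq A k /\ p k = link_seq A k.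
Proof.
case=> aP p0 pP.
have /choice[x xP] k : exists x, (k < n)%N ->
    entry lo k k <= x <= entry hi k k /\ a k = g k * x.
  by case: (ltnP k n) => [/aP[x]|]; [exists x | exists 0].
have /choice[yz yzP] k : exists yz : R * R, (k.+1 < n)%N ->
    [/\ entry lo k k.+1 <= yz.1 <= entry hi k k.+1,
        entry lo k.+1 k <= yz.2 <= entry hi k.+1 k
      & p k.+1 = (g k * yz.1) * (g k.+1 * yz.2)].
  by case: (ltnP k.+1 n) => [/pP[y [z]]|]; [exists (y, z) | exists (0, 0)].
have [||| A AI [Ad Ao]] := @interval_of_bands x (fun k => (yz k).1) (fun k => (yz k).2).
- by move=> k /xP[].
- by move=> k /yzP[].
- by move=> k /yzP[].
exists A => // k kn; split; first by rewrite /diag_seq Ad //; case: (xP k kn).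
case: k kn => [|k] kn; first by rewrite p0 /link_seq /link /= mul0r.
have [_ _ ->] := yzP k kn; have [ey ez] := Ao k kn.
by rewrite /link_seq /link /= /super_seq ey ez mulrC.
Qed.

Lemma interval_dominant A : interval_mx lo hi A ->
  dominant n (diag_seq A) (super_seq A) (sub_seq A).
Proof.
by move=> AI; apply: Hmatrix_dominant => [|k kn]; [exact: lo_hi_H | exact: diag_gt0].
Qed.

Let sdet A := (\prod_(k < n) g k) * \det A.

(** The extremal recursion belongs to a member of the interval, so it is dominant
    and [continuant_le] compares it with any other member. *)
Lemma sdet_max a p : attained a p ->
  (forall A k, interval_mx lo hi A -> (k < n)%N ->
     diag_seq A k <= a k /\ p k <= link_seq A k) ->
  (exists2 A, interval_mx lo hi A & sdet A = continuant a p 0 n 1 0) /\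
  (forall A, interval_mx lo hi A -> sdet A <= continuant a p 0 n 1 0).
Proof.
case/attainedP=> M MI Map bound.
have -> : continuant a p 0 n 1 0 = sdet M.
  by rewrite /sdet det_scaled; [exact: eq_continuant | exact: interval_tridiag].
split=> [|A AI]; first by exists M.
rewrite /sdet !det_scaled; [|exact: interval_tridiag..].
apply: continuant_le => [||k kn|k kn]; try exact: interval_dominant.
  by have [<- _] := Map k kn; case: (bound A k AI kn).
by have [_ e] := Map k kn; case: (bound A k AI kn) => _; rewrite e.
Qed.

Lemma sdet_min a p : attained a p ->
  (forall A k, interval_mx lo hi A -> (k < n)%N ->
     a k <= diag_seq A k /\ link_seq A k <= p k) ->
  (exists2 A, interval_mx lo hi A & sdet A = continuant a p 0 n 1 0) /\
  (forall A, interval_mx lo hi A -> continuant a p 0 n 1 0 <= sdet A).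
Proof.
case/attainedP=> M MI Map bound.
have -> : continuant a p 0 n 1 0 = sdet M.
  by rewrite /sdet det_scaled; [exact: eq_continuant | exact: interval_tridiag].
split=> [|A AI]; first by exists M.
rewrite /sdet !det_scaled; [|exact: interval_tridiag..].
apply: continuant_le => [||k kn|k kn]; try exact: interval_dominant.
  by have [<- _] := Map k kn; case: (bound A k AI kn).
by have [_ e] := Map k kn; case: (bound A k AI kn) => _; rewrite e.
Qed.

End Interval.

(** * Extremal bands *)

Section Extremal.
Variables (R : realType) (n : nat) (lo hi : 'M[R]_n).
Hypothesis lo_hi : lemx lo hi.
Hypothesis lo_hi_tri : interval_tridiagonal lo hi.
Hypothesis lo_hi_H : interval_Hmatrix lo hi.

Definition row_sign k : R := Num.sg (entry lo k k).

Let g := row_sign.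

Definition diag_max k := Num.max (g k * entry lo k k) (g k * entry hi k k).
Definition diag_min k := Num.min (g k * entry lo k k) (g k * entry hi k k).

Definition corner (sel : R -> R -> R -> R -> R) k : R :=
  if k is k'.+1 then
    sel (g k' * entry lo k' k * (g k * entry lo k k'))
        (g k' * entry lo k' k * (g k * entry hi k k'))
        (g k' * entry hi k' k * (g k * entry lo k k'))
        (g k' * entry hi k' k * (g k * entry hi k k'))
  else 0.

Definition link_min := corner (@min4 R).
Definition link_max := corner (@max4 R).

Lemma lo_in : interval_mx lo hi lo. Proof. by split. Qed.
Lemma hi_in : interval_mx lo hi hi. Proof. by split. Qed.

Lemma entry_le i j : entry lo i j <= entry hi i j.
Proof. by have /andP[] := entry_interval i j hi_in. Qed.

Lemma row_sign_norm k : (k < n)%N -> `|g k| = 1.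
Proof.
move=> kn; rewrite normr_sg (entry_ltn _ kn kn).
by rewrite (Hmatrix_diag _ (lo_hi_H lo_in)).
Qed.

(** If the diagonal entry could change sign, the member of the interval obtained
    from [lo] by putting 0 in its place would be an H-matrix with a zero on its
    diagonal. *)
Lemma row_sign_gt0 A k : interval_mx lo hi A -> (k < n)%N ->
  0 < diag_seq g A k.
Proof.
move=> AI kn; rewrite /diag_seq; pose i := Ordinal kn.
have /andP[lA Ah] := entry_interval k k AI.
have := Hmatrix_diag i (lo_hi_H lo_in); rewrite -entryE /= => l0.
rewrite /g /row_sign; case: (sgrP (entry lo k k)) => [l0'|lp|ln].
- by rewrite l0' eqxx in l0.
- by rewrite mul1r; apply: lt_le_trans lA.
rewrite mulN1r oppr_gt0 ltNge; apply/negP => A0.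
pose B : 'M[R]_n := \matrix_(r, c) if (r == i) && (c == i) then 0 else lo r c.
have BI : interval_mx lo hi B.
  split=> r c; rewrite mxE; case: ifP => [/andP[/eqP-> /eqP->]|_] //.
    by rewrite -entryE ltW.
  by rewrite -entryE; apply: le_trans Ah.
by have := Hmatrix_diag i (lo_hi_H BI); rewrite mxE !eqxx.
Qed.

Lemma diag_corner k : (exists2 x, entry lo k k <= x <= entry hi k k & diag_max k = g k * x) /\
  (exists2 x, entry lo k k <= x <= entry hi k k & diag_min k = g k * x).
Proof.
have le := entry_le k k.
rewrite /diag_max /diag_min; case: leP => _.
  by split; [exists (entry hi k k) | exists (entry lo k k)]; rewrite ?lexx ?le.
by split; [exists (entry lo k k) | exists (entry hi k k)]; rewrite ?lexx ?le.
Qed.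

Lemma pick4 (sel : R -> R -> R -> R -> R) (y1 y2 z1 z2 : R) k :
  (forall a b c d : R, sel a b c d \in [:: a; b; c; d]) ->
  y1 <= y2 -> z1 <= z2 -> exists y z, [/\ y1 <= y <= y2, z1 <= z <= z2 &
    sel (g k * y1 * (g k.+1 * z1)) (g k * y1 * (g k.+1 * z2))
        (g k * y2 * (g k.+1 * z1)) (g k * y2 * (g k.+1 * z2))
    = g k * y * (g k.+1 * z)].
Proof.
move=> selP y12 z12.
have := selP (g k * y1 * (g k.+1 * z1)) (g k * y1 * (g k.+1 * z2))
             (g k * y2 * (g k.+1 * z1)) (g k * y2 * (g k.+1 * z2)).
by rewrite !inE => /or4P[] /eqP->; [exists y1, z1 | exists y1, z2 | exists y2, z1
  | exists y2, z2]; rewrite ?lexx ?y12 ?z12.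
Qed.

Lemma min4_mem (a b c d : R) : min4 a b c d \in [:: a; b; c; d].
Proof.
have H (x y : R) : Num.min x y = x \/ Num.min x y = y by case: leP; auto.
rewrite /min4 !inE.
case: (H (Num.min (Num.min a b) c) d) => ->; last by rewrite eqxx !orbT.
case: (H (Num.min a b) c) => ->; last by rewrite eqxx !orbT.
by case: (H a b) => ->; rewrite eqxx ?orbT.
Qed.

Lemma max4_mem (a b c d : R) : max4 a b c d \in [:: a; b; c; d].
Proof.
have H (x y : R) : Num.max x y = x \/ Num.max x y = y by case: leP; auto.
rewrite /max4 !inE.
case: (H (Num.max (Num.max a b) c) d) => ->; last by rewrite eqxx !orbT.
case: (H (Num.max a b) c) => ->; last by rewrite eqxx !orbT.
by case: (H a b) => ->; rewrite eqxx ?orbT.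
Qed.

Lemma attained_max : attained g lo hi diag_max link_min.
Proof.
split=> // k _; first by case: (diag_corner k).
by apply: pick4; [exact: min4_mem | exact: entry_le..].
Qed.

Lemma attained_min : attained g lo hi diag_min link_max.
Proof.
split=> // k _; first by case: (diag_corner k).
by apply: pick4; [exact: max4_mem | exact: entry_le..].
Qed.

Lemma between_entry A i j : interval_mx lo hi A ->
  between (entry lo i j) (entry hi i j) (entry A i j).
Proof.
by move=> /(entry_interval i j)/andP[lA Ah]; rewrite /between mulr_ge0 // subr_ge0.
Qed.

Lemma diag_bounds A k : interval_mx lo hi A ->
  diag_min k <= diag_seq g A k /\ diag_seq g A k <= diag_max k.
Proof. by move=> AI; apply/between_bounds/betweenZ/between_entry. Qed.

Lemma link_bounds A k : interval_mx lo hi A ->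
  link_min k <= link (super_seq g A) (sub_seq g A) k /\
  link (super_seq g A) (sub_seq g A) k <= link_max k.
Proof.
move=> AI; case: k => [|k]; first by rewrite /link mul0r.
rewrite /link mulrC.
by apply: between_mul_bounds; apply/betweenZ/between_entry.
Qed.

Let sdet (A : 'M[R]_n) := (\prod_(k < n) g k) * \det A.

(** Both recursions take their coefficients at corners of the interval, where they
    bound those of every member. *)
Lemma sdet_extrema :
  [/\ exists2 A, interval_mx lo hi A & sdet A = continuant diag_max link_min 0 n 1 0,
      exists2 A, interval_mx lo hi A & sdet A = continuant diag_min link_max 0 n 1 0
    & forall A, interval_mx lo hi A ->
        continuant diag_min link_max 0 n 1 0 <= sdet A
        /\ sdet A <= continuant diag_max link_min 0 n 1 0].
Proof.
have [||M1 M2] := @sdet_max _ _ g row_sign_norm lo hi lo_hi_tri lo_hi_H _ _ _ attained_max.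
- exact: row_sign_gt0.
- by move=> A k AI _; split; [case: (diag_bounds k AI) | case: (link_bounds k AI)].
have [||m1 m2] := @sdet_min _ _ g row_sign_norm lo hi lo_hi_tri lo_hi_H _ _ _ attained_min.
- exact: row_sign_gt0.
- by move=> A k AI _; split; [case: (diag_bounds k AI) | case: (link_bounds k AI)].
by split=> // A AI; split; [exact: m2 | exact: M2].
Qed.

End Extremal.

(** * Bit lengths *)

Lemma bitlen_gt0 z : (0 < bitlen z)%N.
Proof. by []. Qed.

Lemma bitlen_lt z : (`|z| < 2 ^ bitlen z)%N.
Proof. exact: trunc_log_ltn. Qed.

Lemma bitlen_le z b : (0 < b)%N -> (`|z| < 2 ^ b)%N -> (bitlen z <= b)%N.
Proof.
move=> b0 zb; rewrite /bitlen; case: (posnP `|z|%N) => [->|z0].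
  by rewrite trunc_log0.
rewrite -(ltn_exp2l _ _ (ltnSn 1)); apply: leq_ltn_trans zb.
exact: trunc_logP.
Qed.

Lemma bitlenD x y : (bitlen (x + y) <= bitlen x + bitlen y)%N.
Proof.
apply: bitlen_le => //; have := bitlen_lt x; have := bitlen_lt y.
rewrite expnD; move: (bitlen_gt0 x) (bitlen_gt0 y).
case: (bitlen x) (bitlen y) => [|p] [|q] // _ _; rewrite !expnS.
move: (2 ^ p)%N (2 ^ q)%N (expn_gt0 2 p) (expn_gt0 2 q) => P Q; nia.
Qed.

Lemma bitlenN x : bitlen (- x) = bitlen x.
Proof. by rewrite /bitlen abszN. Qed.

Lemma bitlenB x y : (bitlen (x - y) <= bitlen x + bitlen y)%N.
Proof. by rewrite -(bitlenN y) bitlenD. Qed.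

Lemma bitlenM x y : (bitlen (x * y) <= bitlen x + bitlen y)%N.
Proof.
by apply: bitlen_le => //; rewrite abszM expnD ltn_mul // bitlen_lt.
Qed.

Lemma bitlen_mem w z : z \in w -> (bitlen z <= bitsize w)%N.
Proof. by move=> zw; rewrite /bitsize (big_rem z) //= leq_addr. Qed.

(** * Structured programs *)

(** The compiled [While] skips its body by an unconditional jump, which the
    machine lacks; a jump on register 1 serves as one, provided that this register
    holds 1. *)
Inductive cmd : Type :=
| Skip
| Do of instr
| Seq of cmd & cmd
| While of nat & cmd.

Fixpoint csize c : nat :=
  match c with
  | Skip => 0
  | Do _ => 1
  | Seq c1 c2 => csize c1 + csize c2
  | While _ c => (csize c).+3
  end.

Fixpoint compile (b : nat) (c : cmd) : seq instr :=
  match c with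
  | Skip => [::]
  | Do ins => [:: ins]
  | Seq c1 c2 => compile b c1 ++ compile (b + csize c1) c2
  | While j c =>
      [:: Jump b.+2 j, Jump (b + (csize c).+3) 1
        & compile b.+2 c ++ [:: Jump b.+2 j]]
  end.

Lemma size_compile b c : size (compile b c) = csize c.
Proof.
elim: c b => //= [c1 IH1 c2 IH2|j c IH] b; rewrite size_cat ?IH1 ?IH2 //=.
by rewrite IH addn1.
Qed.

Record state : Type := State {
  vals : seq int; tape : seq int; printed : seq int }.

(** Registers are given by a list, extended by zeros, and compared pointwise with
    those of the machine. *)
Definition finishes (P : seq instr) b s T o : Prop :=
  forall X, X =1 nth 0 (vals s) ->
  exists2 t, (t <= T)%N & run P (Config b X (tape s) (printed s)) t o.

Definition placed (P : seq instr) b c : Prop :=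
  forall i, (i < csize c)%N -> onth P (b + i) = onth (compile b c) i.

(** In continuation style, so that the cost of a command is an upper bound and no
    determinism of the machine is needed to compose commands. *)
Definition reaches s c s' t : Prop :=
  forall P b T o, placed P b c -> finishes P (b + csize c) s' T o ->
  finishes P b s (t + T) o.

Lemma reaches_skip s : reaches s Skip s 0.
Proof. by move=> P b T o _; rewrite addn0. Qed.

Lemma reaches_leq s c s' t t' : (t <= t')%N -> reaches s c s' t -> reaches s c s' t'.
Proof.
move=> tt' H P b T o Pl F X sX; have [u ule r] := H P b T o Pl F X sX.
by exists u => //; apply: leq_trans ule _; rewrite leq_add2r.
Qed.

Lemma reaches_seq s1 s2 s3 c d t u :
  reaches s1 c s2 t -> reaches s2 d s3 u -> reaches s1 (Seq c d) s3 (t + u).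
Proof.
move=> H1 H2 P b T o /= Pl F; rewrite -addnA; apply: H1.
  by move=> i ic; rewrite Pl ?ltn_addr //= onth_cat size_compile ic.
apply: H2; last by rewrite -addnA.
move=> i id; rewrite -addnA Pl ?ltn_add2l //= onth_cat size_compile.
by rewrite ltnNge leq_addr /= addKn.
Qed.

Lemma reaches_do ins s s' t :
  (forall b X, X =1 nth 0 (vals s) -> exists k X',
    [/\ exec ins (Config b X (tape s) (printed s))
          = Some (k, Config b.+1 X' (tape s') (printed s')),
        X' =1 nth 0 (vals s') & (k <= t)%N]) ->
  reaches s (Do ins) s' t.
Proof.
move=> H P b T o Pl F X sX; have [k [X' [e sX' kt]]] := H b X sX.
rewrite addn1 in F; have [u uT r] := F X' sX'.
exists (k + u)%N; first exact: leq_add.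
apply: (run_step _ e) => //=.
by have := Pl 0%N isT; rewrite addn0.
Qed.

Lemma finishes_jump P b m j s T o w :
  onth P b = Some (Jump m j) -> (bitlen (vals s)`_j <= w)%N ->
  finishes P (if 0 < (vals s)`_j then m else b.+1) s T o ->
  finishes P b s (w + T) o.
Proof.
move=> Pb jw F X sX; have [t tT r] := F X sX.
exists (bitlen (X j) + t)%N; first by rewrite sX leq_add.
apply: (@run_step P (Config b X (tape s) (printed s)) _ _ _ _ _ Pb erefl).
by rewrite sX.
Qed.

(** The family [s_] is indexed by the number of iterations left; each one costs its
    body [t] and the closing test [w], and the additional [w + 1] pays for entering
    the loop. *)
Lemma reaches_while j c (s_ : nat -> state) w t m :
  (forall i, (i < m)%N -> reaches (s_ i.+1) c (s_ i) t) ->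
  (forall i, (i <= m)%N -> [/\ (vals (s_ i))`_1 = 1,
     (0 < (vals (s_ i))`_j) = (0 < i)%N & (bitlen (vals (s_ i))`_j <= w)%N]) ->
  reaches (s_ m) (While j c) (s_ 0) (m * (t + w) + w.+1).
Proof.
move=> Hc Hs P b T o Pl F.
have P0 : onth P b = Some (Jump b.+2 j) by have := Pl 0%N isT; rewrite addn0.
have P1 : onth P b.+1 = Some (Jump (b + (csize c).+3) 1).
  by have := Pl 1%N isT; rewrite addn1.
have P2 : onth P (b.+2 + csize c) = Some (Jump b.+2 j).
  by rewrite !addSnnS Pl //= onth_cat size_compile ltnn subnn.
have Pc : placed P b.+2 c.
  move=> i ic; rewrite !addSnnS Pl /=; last by lia.
  by rewrite onth_cat size_compile ic.
have loop i : (i < m)%N ->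
    finishes P b.+2 (s_ i.+1) (i.+1 * (t + w) + T) o.
  elim: i => [|i IH] im.
    rewrite mul1n -addnA; apply: Hc => //; apply: (finishes_jump P2 _).
      by have [] := Hs 0%N isT.
    have [_ -> _] := Hs 0%N isT.
    by move: F => /=; rewrite !addnS -!addSn.
  rewrite mulSn -addnA -(addnA t w); apply: Hc => //; apply: (finishes_jump P2 _).
    by have [] := Hs i.+1 (ltnW im).
  by have [_ -> _] := Hs i.+1 (ltnW im); apply: IH; apply: ltnW.
have -> : (m * (t + w) + w.+1 + T = w + (m * (t + w) + (1 + T)))%N by lia.
have [e1 ej jw] := Hs m (leqnn m).
apply: (finishes_jump P0 jw); rewrite ej.
case: m => [|m] /= in Hc Hs loop e1 ej jw *.
  rewrite mul0n add0n; apply: (finishes_jump P1 _); rewrite e1 //.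
move=> X sX; have [u ule r] := loop m (ltnSn m) X sX.
by exists u => //; apply: leq_trans ule _; rewrite leq_add2l leq_addl.
Qed.

(** * Straight-line blocks *)

Inductive arith : Type := Minus | Times | Maximum | Minimum.

Definition arith_val (f : arith) : int -> int -> int :=
  match f with
  | Minus => fun x y => x - y
  | Times => fun x y => x * y
  | Maximum => Num.max
  | Minimum => Num.min
  end.

Inductive op : Type :=
| Put of nat & int
| Get of nat
| Calc of arith & nat & nat & nat.

(** The machine computes neither maxima nor minima. With the difference d of [j]
    and [k] in register 0, register [i] receives one of the two values and is
    corrected by d, in a loop that runs at most once, if d is positive. *)
Definition op_code (a : op) : cmd :=
  match a with
  | Put i z => Do (Const i z)
  | Get i => Do (Read i)
  | Calc Minus i j k => Do (Defs.Sub i j k)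
  | Calc Times i j k => Do (Mul i j k)
  | Calc Maximum i j k =>
      Seq (Do (Defs.Sub 0 j k)) (Seq (Do (Defs.Sub i j 0))
        (Seq (While 0 (Seq (Do (Add i i 0)) (Do (Const 0 0)))) (Do (Const 0 0))))
  | Calc Minimum i j k =>
      Seq (Do (Defs.Sub 0 j k)) (Seq (Do (Add i k 0))
        (Seq (While 0 (Seq (Do (Defs.Sub i i 0)) (Do (Const 0 0)))) (Do (Const 0 0))))
  end.

(** Registers 0 and 1 are reserved: 0 is the scratch register of maxima and minima
    and holds 0 between operations, 1 holds the constant 1. *)
Definition op_wf (a : op) : bool :=
  match a with
  | Put i _ | Get i => 1 < i
  | Calc _ i j k => [&& 1 < i, 0 < j & 0 < k]
  end%N.

Definition op_eval (a : op) (m : seq int * seq int) : seq int * seq int :=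
  match a with
  | Put i z => (set_nth 0 m.1 i z, m.2)
  | Get i => (set_nth 0 m.1 i (head 0 m.2), behead m.2)
  | Calc f i j k => (set_nth 0 m.1 i (arith_val f m.1`_j m.1`_k), m.2)
  end.

Definition is_get (a : op) : bool := if a is Get _ then true else false.

Definition small_op (a : op) : bool := if a is Put _ z then bitlen z == 1%N else true.

Definition bounded (B : nat) (l : seq int) : Prop := forall r, (bitlen l`_r <= B)%N.

Definition ready (l : seq int) : Prop := l`_0 = 0 /\ l`_1 = 1.

Lemma nth_set (l : seq int) i z j :
  (set_nth 0 l i z)`_j = if j == i then z else l`_j.
Proof. by rewrite nth_set_nth. Qed.

Lemma bounded_set B l i z :
  bounded B l -> (bitlen z <= B)%N -> bounded B (set_nth 0 l i z).
Proof. by move=> lB zB r; rewrite nth_set /=; case: eqP. Qed.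

Lemma ready_set l i z : (1 < i)%N -> ready l -> ready (set_nth 0 l i z).
Proof.
by case: i => [|[|i]] // _ [l0 l1]; split; rewrite nth_set.
Qed.

Lemma ready_op a m : op_wf a -> ready m.1 -> ready (op_eval a m).1.
Proof.
by case: a => [i z|i|f i j k] /= wf lr; apply: ready_set => //; case/and3P: wf.
Qed.

Lemma bitlen_arith f x y : (bitlen (arith_val f x y) <= bitlen x + bitlen y)%N.
Proof.
case: f => /=; [exact: bitlenB | exact: bitlenM | |].
  by case: (leP x y) => _; rewrite ?leq_addl ?leq_addr.
by case: (leP x y) => _; rewrite ?leq_addl ?leq_addr.
Qed.

(** Sums, differences and products have at most as many bits as their operands
    together. *)
Lemma bounded_op a m B : small_op a -> bounded B m.1 ->
  (forall z, z \in m.2 -> bitlen z <= B)%N ->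
  bounded (2 * B) (op_eval a m).1.
Proof.
move=> sa lB inB.
have B0 : (0 < B)%N by apply: leq_trans (lB 0%N).
have lB2 : bounded (2 * B) m.1 by move=> r; apply: leq_trans (lB r) _; lia.
case: a sa => [i z|i|f i j k] /= sa; apply: bounded_set => //.
- by rewrite (eqP sa); lia.
- case: (m.2) inB => [|z u] //= inB; first by rewrite /bitlen trunc_log0; lia.
  by apply: leq_trans (inB z _) _; rewrite ?mem_head //; lia.
- apply: leq_trans (bitlen_arith _ _ _) _.
  by rewrite mul2n -addnn leq_add // lB.
Qed.

Lemma reaches_set ins i v l u u' o t :
  (forall b X, X =1 nth 0 l -> exists2 k,
    exec ins (Config b X u o) = Some (k, Config b.+1 [eta X with i |-> v] u' o)
    & (k <= t)%N) ->
  reaches (State l u o) (Do ins) (State (set_nth 0 l i v) u' o) t.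
Proof.
move=> H; apply: reaches_do => b X lX /=; have [k e kt] := H b X lX.
exists k, [eta X with i |-> v]; split => // r.
by rewrite nth_set /= lX.
Qed.

Lemma reaches_const i z l u o :
  reaches (State l u o) (Do (Const i z)) (State (set_nth 0 l i z) u o) 1.
Proof. by apply: reaches_set => b X lX; exists 1%N. Qed.

Lemma reaches_add i j k l u o :
  reaches (State l u o) (Do (Defs.Add i j k))
    (State (set_nth 0 l i (l`_j + l`_k)) u o) (bitlen l`_j + bitlen l`_k).
Proof. by apply: reaches_set => b X lX; eexists; rewrite /= -!lX. Qed.

Lemma reaches_sub i j k l u o :
  reaches (State l u o) (Do (Defs.Sub i j k))
    (State (set_nth 0 l i (l`_j - l`_k)) u o) (bitlen l`_j + bitlen l`_k).
Proof. by apply: reaches_set => b X lX; eexists; rewrite /= -!lX. Qed.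

Lemma reaches_mul i j k l u o :
  reaches (State l u o) (Do (Defs.Mul i j k))
    (State (set_nth 0 l i (l`_j * l`_k)) u o) (bitlen l`_j * bitlen l`_k).
Proof. by apply: reaches_set => b X lX; eexists; rewrite /= -!lX. Qed.

Lemma reaches_read i z l u o :
  reaches (State l (z :: u) o) (Do (Read i)) (State (set_nth 0 l i z) u o)
    (bitlen z).
Proof. by apply: reaches_set => b X lX; eexists. Qed.

Lemma reaches_print i l u o :
  reaches (State l u o) (Do (Print i)) (State l u (rcons o l`_i)) (bitlen l`_i).
Proof.
apply: reaches_do => b X lX /=.
by exists (bitlen (X i)), X; rewrite lX.
Qed.

Lemma reaches_eq_vals l1 l1' u1 o1 c l2 l2' u2 o2 t :
  nth 0 l1 =1 nth 0 l1' -> nth 0 l2 =1 nth 0 l2' ->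
  reaches (State l1 u1 o1) c (State l2 u2 o2) t ->
  reaches (State l1' u1 o1) c (State l2' u2 o2) t.
Proof.
move=> e1 e2 H P b T o Pl F X Xl.
apply: (H P b T o Pl) => [Y Yl|r]; last by rewrite Xl e1.
by apply: F => r; rewrite Yl /= e2.
Qed.

(** The common end of the code for maxima and minima, entered with [d] in register
    0 and the tentative result [x] in register [i]. *)
Lemma reaches_choose (ins : instr) i (d x y : int) l u o B :
  (1 < i)%N -> ready l ->
  (forall l', l'`_0 = d -> l'`_i = x -> reaches (State l' u o) (Do ins)
     (State (set_nth 0 l' i y) u o) (5 * B)) ->
  (bitlen d <= 2 * B)%N ->
  reaches (State (set_nth 0 (set_nth 0 l 0 d) i x) u o)
    (Seq (While 0 (Seq (Do ins) (Do (Const 0 0)))) (Do (Const 0 0)))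
    (State (set_nth 0 l i (if 0 < d then y else x)) u o) (9 * B + 3).
Proof.
move=> i1 [l0 l1] ri dB.
pose s1 := State (set_nth 0 (set_nth 0 l 0 d) i x) u o.
have i0 : (0%N == i) = false by case: i i1 {ri s1}.
have i1' : (1%N == i) = false by case: i i1 {ri s1 i0} => [|[]].
have v0 : (vals s1)`_0 = d by rewrite nth_set /= i0 nth_set.
have v1 : (vals s1)`_1 = 1 by rewrite nth_set /= i1' nth_set.
pose s0 := if 0 < d then State (set_nth 0 (set_nth 0 (vals s1) i y) 0 0) u o
           else s1.
have W : reaches s1 (While 0 (Seq (Do ins) (Do (Const 0 0)))) s0 (9 * B + 2).
  rewrite /s0; case: ifPn => d0; last first.
    apply: (@reaches_leq _ _ _ (0 * (0 + 2 * B) + (2 * B).+1)); first by lia.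
    apply: (@reaches_while _ _ (fun=> s1)) => // k; rewrite leqn0 => /eqP->.
    by rewrite v0 (negbTE d0).
  pose s_ k := if k is 0 then State (set_nth 0 (set_nth 0 (vals s1) i y) 0 0) u o
               else s1.
  apply: (@reaches_leq _ _ _ (1 * ((5 * B + 1) + 2 * B) + (2 * B).+1)).
    by lia.
  apply: (@reaches_while _ _ s_ _ _ 1) => [[|//] _|[|[|//]] _].
  - apply: (@reaches_seq _ (State (set_nth 0 (vals s1) i y) u o)).
      by apply: ri => //; rewrite nth_set /= eqxx.
    exact: reaches_const.
  - split; rewrite /= nth_set_nth //= ?nth_set /= ?i1' //.
    by apply: leq_trans (_ : 1 <= _)%N => //; apply: leq_trans dB.
  - by rewrite v0.
rewrite (_ : 9 * B + 3 = (9 * B + 2) + 1)%N; last by lia.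
apply: reaches_seq W _.
have -> : s0 = State (vals s0) u o by rewrite /s0; case: ifP.
apply: (@reaches_eq_vals _ _ _ _ _ _ _ _ _ _ (fun=> erefl) _
  (@reaches_const 0 0 (vals s0) u o)) => r.
rewrite !nth_set /=; case: (r =P 0%N) => [->|r0].
  by rewrite i0 l0.
move/eqP/negbTE: r0 => r0.
rewrite /s0; case: ifP => _ /=; rewrite !nth_set /= ?r0 ?nth_set /=;
  case: eqP => // /eqP/negbTE ri'; rewrite ?nth_set /= ?ri' ?nth_set /= ?r0 //.
Qed.

Lemma reaches_op a (l u o : seq int) B :
  op_wf a -> ready l -> bounded B l -> (forall z, z \in u -> bitlen z <= B)%N ->
  (is_get a <= size u)%N ->
  reaches (State l u o) (op_code a)
    (State (op_eval a (l, u)).1 (op_eval a (l, u)).2 o) (17 * B ^ 2).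
Proof.
move=> wf lr lB uB gu.
have B0 : (0 < B)%N by apply: leq_trans (lB 0%N).
have BB : (B <= B ^ 2)%N by rewrite leq_pmulr.
case: a wf gu => [i z|i|f i j k] /= wf gu.
- by apply: reaches_leq (@reaches_const _ _ _ _ _); lia.
- case: u uB gu => [//|z u] uB _ /=; apply: reaches_leq (@reaches_read _ _ _ _ _).
  by apply: leq_trans (uB z _) _; rewrite ?mem_head //; lia.
have jB := lB j; have kB := lB k; have [l0 l1] := lr.
case/and3P: wf => i1 j0 k0.
have dB : (bitlen (l`_j - l`_k) <= 2 * B)%N.
  by apply: leq_trans (bitlenB _ _) _; lia.
have j0' : (j == 0%N) = false by case: j j0 {jB dB}.
have k0' : (k == 0%N) = false by case: k k0 {kB dB}.
case: f => /=.
- by apply: reaches_leq (@reaches_sub _ _ _ _ _ _); lia.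
- apply: reaches_leq (@reaches_mul _ _ _ _ _ _).
  by apply: leq_trans (leq_mul jB kB) _; lia.
- apply: (@reaches_leq _ _ _ (2 * B + (3 * B + (9 * B + 3)))); first by lia.
  apply: reaches_seq.
    by apply: reaches_leq (@reaches_sub _ _ _ _ _ _); lia.
  apply: reaches_seq.
    apply: reaches_leq (@reaches_sub _ _ _ _ _ _).
    rewrite !nth_set /= j0' /=.
    by apply: leq_trans (leq_add jB dB) _; lia.
  rewrite !nth_set /= j0' /=.
  have -> : Num.max l`_j l`_k = if 0 < l`_j - l`_k then l`_j else l`_k.
    by rewrite subr_gt0 /Num.max; case: ltgtP.
  rewrite (_ : l`_j - (l`_j - l`_k) = l`_k); last by ring.
  apply: reaches_choose => // l' d' x'.
  rewrite (_ : l`_j = l'`_i + l'`_0); last by rewrite d' x'; ring.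
  apply: reaches_leq (@reaches_add _ _ _ _ _ _); rewrite d' x'.
  by apply: leq_trans (leq_add kB dB) _; lia.
- apply: (@reaches_leq _ _ _ (2 * B + (3 * B + (9 * B + 3)))); first by lia.
  apply: reaches_seq.
    by apply: reaches_leq (@reaches_sub _ _ _ _ _ _); lia.
  apply: reaches_seq.
    apply: reaches_leq (@reaches_add _ _ _ _ _ _).
    rewrite !nth_set /= k0' /=.
    by apply: leq_trans (leq_add kB dB) _; lia.
  rewrite !nth_set /= k0' /=.
  have -> : Num.min l`_j l`_k = if 0 < l`_j - l`_k then l`_k else l`_j.
    by rewrite subr_gt0 /Num.min; case: ltgtP.
  rewrite (_ : l`_k + (l`_j - l`_k) = l`_j); last by ring.
  apply: reaches_choose => // l' d' x'.
  rewrite (_ : l`_k = l'`_i - l'`_0); last by rewrite d' x'; ring.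
  apply: reaches_leq (@reaches_sub _ _ _ _ _ _); rewrite d' x'.
  by apply: leq_trans (leq_add jB dB) _; lia.
Qed.

Fixpoint block (p : seq op) : cmd :=
  if p is a :: p' then Seq (op_code a) (block p') else Skip.

Definition eval (p : seq op) (m : seq int * seq int) : seq int * seq int :=
  foldl (fun m a => op_eval a m) m p.

Lemma op_eval_tape a m z : z \in (op_eval a m).2 -> z \in m.2.
Proof. by case: a => //= _; apply: mem_behead. Qed.

(** All operations of the block are charged as if they worked on the longest
    registers that the block can produce. *)
Lemma reaches_block p (l u o : seq int) B :
  all op_wf p -> all small_op p -> ready l -> bounded B l ->
  (forall z, z \in u -> bitlen z <= B)%N -> (count is_get p <= size u)%N ->
  reaches (State l u o) (block p) (State (eval p (l, u)).1 (eval p (l, u)).2 o)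
    (size p * (17 * (2 ^ size p * B) ^ 2)).
Proof.
elim: p l u B => [|a p IH] l u B /=; first by move=> *; apply: reaches_skip.
case/andP=> wfa wfp /andP[sa sp] lr lB uB cu.
have au : (is_get a <= size u)%N by apply: leq_trans cu; rewrite leq_addr.
have Ha := @reaches_op a l u o B wfa lr lB uB au.
have -> : op_eval a (l, u) = ((op_eval a (l, u)).1, (op_eval a (l, u)).2).
  by case: op_eval.
(* After one operation the bound doubles and the block is shorter by one. *)
have e2 : (2 ^ size p * (2 * B) = 2 ^ (size p).+1 * B)%N by rewrite expnSr mulnA.
have {IH} := IH (op_eval a (l, u)).1 (op_eval a (l, u)).2 (2 * B)%N wfp sp.
rewrite e2 mulSn => IH; apply: reaches_seq; last apply: IH.
- apply: reaches_leq Ha; rewrite leq_mul2l leq_exp2r //= leq_pmull //.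
  by rewrite expn_gt0.
- exact: (@ready_op a (l, u)).
- exact: (@bounded_op a (l, u)).
- move=> z /op_eval_tape /uB zB; apply: leq_trans zB _; lia.
- by case: a au cu {Ha sa wfa} => [i z|i|f i j k] /= _; rewrite ?add0n // size_behead; lia.
Qed.

Lemma bounded_eval p (l u : seq int) B : all small_op p -> bounded B l ->
  (forall z, z \in u -> bitlen z <= B)%N ->
  bounded (2 ^ size p * B) (eval p (l, u)).1.
Proof.
elim: p l u B => [|a p IH] l u B /=; first by rewrite mul1n.
case/andP=> sa sp lB uB; rewrite expnSr -mulnA.
have -> : op_eval a (l, u) = ((op_eval a (l, u)).1, (op_eval a (l, u)).2).
  by case: op_eval.
apply: IH => //; first exact: (@bounded_op a (l, u)).
by move=> z /op_eval_tape /uB zB; apply: leq_trans zB _; lia.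
Qed.

Lemma placed_compile c : placed (compile 0 c) 0 c.
Proof. by []. Qed.

Lemma reaches_run c w s t :
  reaches (State [::] w [::]) c s t ->
  exists2 t', (t' <= t)%N & run (compile 0 c) (start w) t' (printed s).
Proof.
move=> H; have Xl : (fun=> 0) =1 nth 0 ([::] : seq int) by move=> r; rewrite nth_nil.
have F : finishes (compile 0 c) (0 + csize c) s 0 (printed s).
  move=> X _; exists 0%N => //.
  apply: (@run_halt _ (Config (0 + csize c) X (tape s) (printed s))).
  by rewrite onth_default //= size_compile.
have [t'] := H (compile 0 c) 0%N 0%N (printed s) (@placed_compile c) F (fun=> 0) Xl.
by rewrite addn0 => t't r; exists t'.
Qed.

(** * The program *)

Definition interval_code (f : qfrac * qfrac) : seq int :=
  qfrac_code f.1 ++ qfrac_code f.2.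

(** Numerators of the two endpoints of an interval, and their common
    denominator. *)
Definition triple : Type := (int * int * int)%type.

Definition common (f : qfrac * qfrac) : triple :=
  (qnum f.1 * qden f.2, qnum f.2 * qden f.1, qden f.1 * qden f.2).

Definition scale (g : int) (b : triple) : triple := (b.1.1 * g, b.1.2 * g, b.2).

(** The sign of an integer, by means of the available operations. *)
Definition clamp (x : int) : int := Num.max (Num.min x 1) (-1).

(** [rsgn] is the sign of the last row, [dsgn] the product of the signs so far;
    [big] and [big'] are the last two terms of the recursion for the largest scaled
    determinant and [sml], [sml'] those for the smallest one, all four to be
    divided by [denom]. *)
Record track : Type := Track {
  rsgn : int; dsgn : int;
  big : int; big' : int; sml : int; sml' : int;
  denom : int }.

Definition track0 : track := Track 1 1 1 0 1 0 1.

(** The triple [b] holds the preceding superdiagonal entry already scaled by the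
    sign of its row, while [c] and [a], of the new row, are unscaled: their sign is
    known only once [a] has been read. *)
Definition absorb_row (b c a : triple) (s : track) : track :=
  let g := clamp a.1.1 in
  let a := scale g a in
  let c := scale g c in
  let pmin := min4 (b.1.1 * c.1.1) (b.1.1 * c.1.2) (b.1.2 * c.1.1) (b.1.2 * c.1.2) in
  let pmax := max4 (b.1.1 * c.1.1) (b.1.1 * c.1.2) (b.1.2 * c.1.1) (b.1.2 * c.1.2) in
  let pden := b.2 * c.2 in
  let amax := Num.max a.1.1 a.1.2 in
  let amin := Num.min a.1.1 a.1.2 in
  Track g (dsgn s * g)
    (amax * pden * big s - pmin * a.2 * big' s) (big s * (a.2 * pden))
    (amin * pden * sml s - pmax * a.2 * sml' s) (sml s * (a.2 * pden))
    (denom s * (a.2 * pden)).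

(** The register list between two blocks. Registers that only hold intermediate
    values are zeros there, so that one bound for the listed values bounds them
    all. *)
Definition regs_bc n k j (s : track) (b c : triple) : seq int :=
  [:: 0; 1; n; k; j; rsgn s; dsgn s; big s; big' s; sml s; sml' s; denom s;
      b.1.1; b.1.2; b.2; 0; 0; 0; 0; c.1.1; c.1.2; c.2] ++ nseq 10 0.

Definition regs n k j s b : seq int := regs_bc n k j s b (0, 0, 0).

Definition get_interval r : seq op :=
  [:: Get 15; Get 16; Get 17; Get 18; Calc Times r 15 18; Calc Times r.+1 17 16;
      Calc Times r.+2 16 18].

Definition clear (s : seq nat) : seq op := [seq Put r 0 | r <- s].

Definition init_ops : seq op :=
  [:: Get 2; Put 5 1; Put 6 1; Put 7 1; Put 9 1; Put 11 1;
      Calc Minus 3 2 31; Put 31 0].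

Definition row_ops : seq op :=
  get_interval 22 ++
  [:: Put 15 (-1); Calc Minimum 5 22 1; Calc Maximum 5 5 15; Calc Times 6 6 5;
      Calc Times 22 22 5; Calc Times 23 23 5; Calc Times 19 19 5; Calc Times 20 20 5;
      Calc Times 25 12 19; Calc Times 26 12 20; Calc Times 27 13 19; Calc Times 28 13 20;
      Calc Minimum 29 25 26; Calc Minimum 29 29 27; Calc Minimum 29 29 28;
      Calc Maximum 30 25 26; Calc Maximum 30 30 27; Calc Maximum 30 30 28;
      Calc Times 31 14 21; Calc Maximum 15 22 23; Calc Minimum 16 22 23;
      Calc Times 18 24 31;
      Calc Times 15 15 31; Calc Times 15 15 7; Calc Times 17 29 24; Calc Times 17 17 8;
      Calc Times 8 7 18; Calc Minus 7 15 17;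
      Calc Times 16 16 31; Calc Times 16 16 9; Calc Times 17 30 24; Calc Times 17 17 10;
      Calc Times 10 9 18; Calc Minus 9 16 17;
      Calc Times 11 11 18; Calc Minus 3 3 1]
  ++ clear (iota 12 20).

(** The first row has no off-diagonal entry on its left: taking 0/1 for it and for
    its partner makes the first link 0. *)
Definition first_ops : seq op := [:: Put 14 1, Put 21 1 & row_ops].

Definition super_ops : seq op :=
  get_interval 12 ++
  [:: Calc Times 12 12 5; Calc Times 13 13 5; Calc Minus 4 2 1; Calc Minus 4 4 1]
  ++ clear (iota 15 4).

Definition skip_ops : seq op :=
  [:: Get 15; Get 15; Get 15; Get 15; Put 15 0; Calc Minus 4 4 1].

Definition next_ops : seq op := get_interval 19 ++ row_ops.

Definition final_ops : seq op :=
  [:: Calc Times 15 6 7; Calc Times 16 6 9; Calc Minimum 17 15 16;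
      Calc Maximum 18 15 16].

Definition next_row : cmd :=
  Seq (block super_ops) (Seq (While 4 (block skip_ops)) (block next_ops)).

Definition print_results : cmd :=
  Seq (Do (Print 17)) (Seq (Do (Print 11)) (Seq (Do (Print 18)) (Do (Print 11)))).

(** The outer loop runs at most once, since the inner one brings its counter to 0:
    it is a conditional that skips the rows of an empty matrix. *)
Definition det_program : cmd :=
  Seq (Do (Const 1 1)) (Seq (block init_ops)
    (Seq (While 3 (Seq (block first_ops) (While 3 next_row)))
      (Seq (block final_ops) print_results))).

Lemma eval_init n u :
  eval init_ops ([:: 0; 1], n :: u) = (regs n (n - 0) 0 track0 (0, 0, 0), u).
Proof. by []. Qed.

Lemma eval_first n k s f u :
  eval first_ops (regs n k 0 s (0, 0, 0), interval_code f ++ u)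
  = (regs n (k - 1) 0 (absorb_row (0, 0, 1) (0, 0, 1) (common f) s) (0, 0, 0), u).
Proof. by []. Qed.

Lemma eval_super n k s f u :
  eval super_ops (regs n k 0 s (0, 0, 0), interval_code f ++ u)
  = (regs n k (n - 1 - 1) s (scale (rsgn s) (common f)), u).
Proof. by []. Qed.

Lemma eval_skip n k j s b f u :
  eval skip_ops (regs n k j s b, interval_code f ++ u) = (regs n k (j - 1) s b, u).
Proof. by []. Qed.

Lemma eval_next n k s b f h u :
  eval next_ops (regs n k 0 s b, interval_code f ++ interval_code h ++ u)
  = (regs n (k - 1) 0 (absorb_row b (common f) (common h) s) (0, 0, 0), u).
Proof. by []. Qed.

Lemma cost_bound n N W T B :
  (W <= T -> B <= W -> 0 < B -> 0 < N -> n <= N ->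
   1 + (T + ((T + (n.-1 * (T + ((n.-2 * (T + W) + W.+1) + T) + B) + B.+1)
     + B + B.+1) + (T + 4 * W))) <= 30 * (T * N ^ 2))%N.
Proof.
move=> WT BW B0 N0 nN.
have NT : (T <= N * T)%N by rewrite leq_pmull.
have NNT : (N * T <= T * N ^ 2)%N.
  by rewrite -mulnn mulnA [(T * N)%N]mulnC leq_pmulr.
have H1 : (n.-2 * (T + W) <= N * T + N * T)%N.
  by rewrite -mulnDr; apply: leq_mul; lia.
have H2 : (n.-1 * (T + ((n.-2 * (T + W) + W.+1) + T) + B) <= 8 * (T * N ^ 2))%N.
  apply: (@leq_trans (N * (8 * (N * T)))); first by apply: leq_mul; lia.
  by rewrite -mulnn; lia.
lia.
Qed.

Section Run.
Variables (n : nat) (C : nat -> nat -> qfrac * qfrac).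

Fixpoint tracks k : track :=
  match k with
  | 0 => track0
  | k'.+1 =>
      if k' is k''.+1 then
        absorb_row (scale (rsgn (tracks k')) (common (C k'' k'))) (common (C k' k''))
          (common (C k' k')) (tracks k')
      else absorb_row (0, 0, 1) (0, 0, 1) (common (C 0 0)) track0
  end.

(** What remains of the input when [m] of the [n * n] cells have been read. *)
Definition stream m : seq int :=
  flatten [seq interval_code (C (p %/ n) (p %% n)) | p <- iota m (n * n - m)].

Lemma streamS m : (m < n * n)%N ->
  stream m = interval_code (C (m %/ n) (m %% n)) ++ stream m.+1.
Proof. by move=> mn; rewrite /stream -(subnSK mn) /=. Qed.

Lemma stream_next i j : (i < n)%N -> (j < n)%N ->
  stream (i * n + j) = interval_code (C i j) ++ stream (i * n + j).+1.
Proof.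
move=> iN jN; rewrite streamS; last first.
  have : (i.+1 * n <= n * n)%N by rewrite leq_mul2r iN orbT.
  by apply: leq_trans; rewrite mulSn addnC ltn_add2r.
have n0 : (0 < n)%N by apply: leq_trans jN.
by rewrite divnMDl // divn_small // addn0 modnMDl modn_small.
Qed.

Lemma stream_sub m z : z \in stream m -> z \in stream 0.
Proof.
have [mn|] := leqP m (n * n).
  rewrite /stream subn0 -[in X in _ -> X](subnKC mn) iotaD map_cat flatten_cat.
  by rewrite mem_cat add0n => ->; rewrite orbT.
by move=> nm; rewrite /stream (_ : n * n - m = 0)%N //; lia.
Qed.

Lemma size_stream m : size (stream m) = (4 * (n * n - m))%N.
Proof.
rewrite /stream; move: (n * n - m)%N => p; elim: p m => //= p IH m.
by rewrite IH mulnSr addnC.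
Qed.

Definition input_size : nat := bitsize (n%:Z :: stream 0).

Lemma stream_small m z : z \in stream m -> (bitlen z <= input_size)%N.
Proof.
by move/stream_sub=> zs; apply: bitlen_mem; rewrite in_cons zs orbT.
Qed.

Lemma input_size_gt0 : (0 < input_size)%N.
Proof. by rewrite /input_size /bitsize big_cons. Qed.

Lemma leq_size_bitsize w : (size w <= bitsize w)%N.
Proof.
rewrite /bitsize; elim: w => [|z w IH] //=; rewrite big_cons.
by rewrite -add1n leq_add.
Qed.

Lemma dim_small : (n <= input_size)%N.
Proof.
apply: leq_trans (leq_size_bitsize _); rewrite /= size_stream subn0; nia.
Qed.

(** * Growth of the registers *)

Definition fits (W : int) (s : track) : Prop :=
  [/\ `|rsgn s| <= 1, `|dsgn s| <= 1, `|big s| <= W, `|big' s| <= W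
    & [/\ `|sml s| <= W, `|sml' s| <= W & `|denom s| <= W]].

Definition triple_le (X : int) (b : triple) : Prop :=
  [/\ `|b.1.1| <= X, `|b.1.2| <= X & `|b.2| <= X].

Lemma norm_clamp x : `|clamp x| <= 1 :> int.
Proof. by rewrite /clamp; case: (leP x 1) => x1; case: leP; lia. Qed.

Lemma norm_max (x y X : int) : `|x| <= X -> `|y| <= X -> `|Num.max x y| <= X.
Proof. by case: (leP x y). Qed.

Lemma norm_min (x y X : int) : `|x| <= X -> `|y| <= X -> `|Num.min x y| <= X.
Proof. by case: (leP x y). Qed.

Lemma norm_mul (x y X Y : int) : `|x| <= X -> `|y| <= Y -> `|x * y| <= X * Y.
Proof. by move=> xX yY; rewrite normrM ler_pM. Qed.

Lemma triple_le_scale X g b : `|g| <= 1 -> triple_le X b -> triple_le X (scale g b).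
Proof.
by move=> g1 [b1 b2 b3]; split => //=; rewrite -(mulr1 X) norm_mul.
Qed.

(** With entries at most [X], the interval triples are at most [X ^+ 2] and the
    links [X ^+ 4]; the new terms are sums of two products of size
    [X ^+ 6 * W]. *)
Lemma fits_row X W b c a s : 2 <= X -> 0 <= W ->
  triple_le (X ^+ 2) b -> triple_le (X ^+ 2) c -> triple_le (X ^+ 2) a ->
  fits W s -> fits (X ^+ 7 * W) (absorb_row b c a s).
Proof.
move=> X2 W0 bX cX aX [g1 d1 S1 S2 [T1 T2 E1]].
have G := norm_clamp a.1.1.
have [{}c1 c2 c3] := triple_le_scale G cX; have [{}b1 b2 b3] := bX.
have [a1 a2 a3] := triple_le_scale G aX.
have P x y : `|x| <= X ^+ 2 -> `|y| <= X ^+ 2 -> `|x * y| <= X ^+ 4.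
  by move=> xX yX; rewrite (_ : 4 = 2 + 2)%N // exprD norm_mul.
have Q x y : `|x| <= X ^+ 2 -> `|y| <= X ^+ 4 -> `|x * y| <= X ^+ 6.
  by move=> xX yX; rewrite (_ : 6 = 2 + 4)%N // exprD norm_mul.
have X6 : 0 <= X ^+ 6 * W by rewrite mulr_ge0 // exprn_ge0 //; lia.
have X7 : X ^+ 6 * W + X ^+ 6 * W <= X ^+ 7 * W.
  by rewrite (exprS _ 6) -mulrA -mulr2n -mulr_natl ler_wpM2r.
have X6' : X ^+ 6 * W <= X ^+ 7 * W by apply: le_trans X7; rewrite lerDl.
have D x y z t u v : `|x| <= X ^+ 2 -> `|y| <= X ^+ 4 -> `|z| <= W ->
    `|t| <= X ^+ 4 -> `|u| <= X ^+ 2 -> `|v| <= W ->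
    `|x * y * z - t * u * v| <= X ^+ 7 * W.
  move=> *; apply: le_trans (ler_normB _ _) _; apply: le_trans X7.
  by apply: lerD; apply: norm_mul => //; [exact: Q | rewrite mulrC; exact: Q].
have M x y z : `|x| <= W -> `|y| <= X ^+ 2 -> `|z| <= X ^+ 4 ->
    `|x * (y * z)| <= X ^+ 7 * W.
  by move=> *; apply: le_trans X6'; rewrite mulrC norm_mul // Q.
have p11 := P _ _ b1 c1; have p12 := P _ _ b1 c2.
have p21 := P _ _ b2 c1; have p22 := P _ _ b2 c2.
have pd := P _ _ b3 c3.
split => //=; last split.
- by rewrite -(mulr1 1) norm_mul.
- by apply: D => //; [exact: norm_max | do !apply: norm_min].
- exact: M.
- by apply: D => //; [exact: norm_min | do !apply: norm_max].
- exact: M.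
- exact: M.
Qed.

Let X : int := 2 ^+ input_size.

Lemma X_ge2 : 2 <= X.
Proof.
rewrite /X; case: input_size input_size_gt0 => // p _.
by rewrite exprS -{1}(mulr1 2) ler_pM2l // exprn_ege1.
Qed.

Lemma norm_bitlen (z : int) : (bitlen z <= input_size)%N -> `|z| <= X.
Proof.
move=> zN; have zl := bitlen_lt z.
rewrite -abszE /X -(natrX int 2) natz lez_nat ltnW //.
by apply: leq_trans zl _; rewrite leq_exp2l.
Qed.

Lemma common_small i j : (i < n)%N -> (j < n)%N -> triple_le (X ^+ 2) (common (C i j)).
Proof.
move=> iN jN; have s z : z \in interval_code (C i j) -> `|z| <= X.
  move=> zs; apply: norm_bitlen; apply: (@stream_small (i * n + j)).
  by rewrite stream_next // mem_cat zs.
by split; rewrite expr2 norm_mul //; apply: s; rewrite !inE eqxx ?orbT.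
Qed.

Lemma tracks_fit k : (k <= n)%N -> fits (X ^+ (7 * k)) (tracks k).
Proof.
have X0 : 0 <= X by apply: le_trans X_ge2.
have t0 : triple_le (X ^+ 2) (0, 0, 1).
  by split; rewrite ?normr0 ?normr1 ?exprn_ge0 // exprn_ege1 //; have := X_ge2; lia.
elim: k => [|[|k] IH] kn.
- by rewrite muln0 expr0.
- rewrite muln1 -(mulr1 (X ^+ 7)); apply: fits_row => //; first exact: X_ge2.
  exact: common_small.
- rewrite mulnS exprD; apply: fits_row; rewrite ?exprn_ge0 //.
  + exact: X_ge2.
  + apply: triple_le_scale; first by case: (IH (ltnW kn)).
    by apply: common_small; lia.
  + by apply: common_small; lia.
  + by apply: common_small; lia.
  + exact: IH (ltnW kn).
Qed.

Let B : nat := (8 * input_size ^ 2)%N.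

Lemma bitlen_bound k (z : int) : (k <= n)%N -> `|z| <= X ^+ (7 * k) -> (bitlen z <= B)%N.
Proof.
move=> kn zX; have N0 := input_size_gt0; have nN := dim_small.
apply: bitlen_le; first by rewrite muln_gt0 expn_gt0 N0.
move: zX; rewrite -abszE /X -exprM -(natrX int 2) natz lez_nat => zX.
apply: leq_ltn_trans zX _; rewrite ltn_exp2l // /B; nia.
Qed.

Lemma bitlen_small (z : int) : (`|z| <= n)%N -> (bitlen z <= B)%N.
Proof.
move=> zn; have N0 := input_size_gt0; have nN := dim_small.
apply: bitlen_le; first by rewrite muln_gt0 expn_gt0 N0.
apply: leq_ltn_trans (ltn_expl _ (ltnSn 1)); apply: leq_trans zn _.
by rewrite /B; nia.
Qed.

Lemma bounded_regs m i j k : (m <= n)%N -> (i <= n)%N -> (j <= n)%N -> (k <= n)%N ->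
  bounded B (regs m%:Z i%:Z j%:Z (tracks k) (0, 0, 0)).
Proof.
move=> mn iN jn kn; have N0 := input_size_gt0.
have B0 : (0 < B)%N by rewrite muln_gt0 expn_gt0 N0.
have [g d S S' [T T' E]] := tracks_fit kn.
have s1 (z : int) : `|z| <= 1 -> (bitlen z <= B)%N.
  by move=> z1; apply: (@bitlen_bound 0).
have w (z : int) : `|z| <= X ^+ (7 * k) -> (bitlen z <= B)%N by exact: bitlen_bound.
do 22?[case => [|] /=; first by first [exact: bitlen_small | exact: s1 | exact: w]].
by move=> r; rewrite -[X in X`_r]/(nseq 10 0) nth_nseq if_same.
Qed.

(** * Running time *)

Variable L : nat.
Hypothesis long_enough : (100 <= L)%N.

(** A block is charged from registers of [2 ^ L * B] bits: at the ends of a row they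
    have at most [B] bits, but inside a row one block of at most [L] operations
    has already been run. *)
Let T : nat := (L * (17 * (2 ^ L * (2 ^ L * B)) ^ 2))%N.

Lemma B_gt0 : (0 < B)%N.
Proof. by rewrite muln_gt0 expn_gt0 input_size_gt0. Qed.

Lemma input_leq_B : (input_size <= B)%N.
Proof. rewrite /B; have := input_size_gt0; nia. Qed.

Lemma tape_bounded m z : z \in stream m -> (bitlen z <= B)%N.
Proof. by move/stream_small=> zN; apply: leq_trans zN input_leq_B. Qed.

Lemma block_cost p (l u : seq int) l' u' :
  eval p (l, u) = (l', u') -> (size p <= 100)%N ->
  all op_wf p -> all small_op p -> ready l -> bounded (2 ^ L * B) l ->
  (forall z, z \in u -> bitlen z <= B)%N -> (count is_get p <= size u)%N ->
  reaches (State l u [::]) (block p) (State l' u' [::]) T.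
Proof.
move=> e /leq_trans/(_ long_enough) pL wfp sp lr lB uB cu.
have uB' z : z \in u -> (bitlen z <= 2 ^ L * B)%N.
  by move/uB => zB; apply: leq_trans zB _; rewrite leq_pmull // expn_gt0.
have := @reaches_block _ _ _ [::] _ wfp sp lr lB uB' cu; rewrite e; apply: reaches_leq.
by rewrite leq_mul // leq_mul2l leq_exp2r //= leq_mul2r leq_exp2l // pL orbT.
Qed.

Lemma bounded_wide l : bounded B l -> bounded (2 ^ L * B) l.
Proof.
by move=> lB r; apply: leq_trans (lB r) _; rewrite leq_pmull // expn_gt0.
Qed.

Lemma succK m : m.+1%:Z - 1 = m%:Z.
Proof. by rewrite intS addrC addKr. Qed.

Lemma bounded_counter W m r j j' s b :
  bounded W (regs m r j s b) -> (bitlen j' <= W)%N -> bounded W (regs m r j' s b).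
Proof.
move=> bW jW i; have := bW i.
by case: i => [|[|[|[|[|i]]]]].
Qed.

(** Between the superdiagonal entry of one row and the subdiagonal entry of the
    next one there are [n - 2] cells in row-major order. *)
Lemma run_skip k r b m :
  (2 <= n)%N -> (m + n.-2 <= n * n)%N ->
  bounded (2 ^ L * B) (regs n r (n.-2)%:Z (tracks k) b) ->
  reaches (State (regs n r (n.-2)%:Z (tracks k) b) (stream m) [::])
    (While 4 (block skip_ops))
    (State (regs n r 0 (tracks k) b) (stream (m + n.-2)) [::])
    (n.-2 * (T + 2 ^ L * B) + (2 ^ L * B).+1).
Proof.
move=> n2 mn bd.
pose s_ j := State (regs n r j%:Z (tracks k) b) (stream (m + (n.-2 - j))) [::].
have bdj j : (j <= n.-2)%N -> bounded (2 ^ L * B) (regs n r j%:Z (tracks k) b).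
  move=> jn; apply: bounded_counter bd _.
  apply: leq_trans (bitlen_small _) _; first by rewrite absz_nat; lia.
  by rewrite leq_pmull // expn_gt0.
have := @reaches_while 4 (block skip_ops) s_ (2 ^ L * B) T n.-2.
rewrite /s_ subnn addn0 subn0; apply => [j jn|j jn]; last first.
  by split => //; apply: (bdj j jn 4%N).
have e : stream (m + (n.-2 - j.+1))
    = interval_code (C ((m + (n.-2 - j.+1)) %/ n) ((m + (n.-2 - j.+1)) %% n))
      ++ stream (m + (n.-2 - j)).
  by rewrite streamS; [rewrite -addnS subnSK | lia].
apply: block_cost => //.
- by rewrite e eval_skip succK.
- exact: bdj.
- exact: tape_bounded.
- by rewrite e.
Qed.

(** A row starts at the superdiagonal cell of the row above it, which is the first
    one not yet read. *)
Lemma run_next_row k r : (k.+1 < n)%N -> (r < n)%N ->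
  reaches
    (State (regs n r.+1%:Z 0 (tracks k.+1) (0, 0, 0)) (stream (k * n + k.+1)) [::])
    next_row
    (State (regs n r%:Z 0 (tracks k.+2) (0, 0, 0)) (stream (k.+1 * n + k.+2)) [::])
    (T + ((n.-2 * (T + 2 ^ L * B) + (2 ^ L * B).+1) + T)).
Proof.
move=> kn rn.
have bd := bounded_regs (leqnn n) rn (leq0n n) (ltnW kn).
have kn2 : (k.+2 * n <= n * n)%N by rewrite leq_mul2r kn orbT.
have e1 : n%:Z - 1 - 1 = (n.-2)%:Z by case: n kn => [|[|p]] // _; rewrite !succK.
have ev : eval super_ops (regs n r.+1%:Z 0 (tracks k.+1) (0, 0, 0),
                          stream (k * n + k.+1))
  = (regs n r.+1%:Z (n.-2)%:Z (tracks k.+1)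
       (scale (rsgn (tracks k.+1)) (common (C k k.+1))), stream (k * n + k.+1).+1).
  by rewrite stream_next ?eval_super ?e1 //; apply: ltnW.
have bd' : bounded (2 ^ L * B) (regs n r.+1%:Z (n.-2)%:Z (tracks k.+1)
       (scale (rsgn (tracks k.+1)) (common (C k k.+1)))).
  have := @bounded_eval super_ops _ (stream (k * n + k.+1)) _ isT bd.
  rewrite ev => H i; apply: leq_trans (H _ i) _.
    exact: tape_bounded.
  rewrite leq_mul2r leq_exp2l //; apply/orP; right.
  exact: leq_trans long_enough.
apply: reaches_seq.
  apply: (block_cost ev) => //.
  - exact: bounded_wide.
  - exact: tape_bounded.
  - by rewrite size_stream /=; nia.
apply: reaches_seq.
  by apply: run_skip bd'; nia.
have -> : ((k * n + k.+1).+1 + n.-2 = k.+1 * n + k)%N by rewrite mulSn; lia.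
apply: block_cost => //.
- rewrite stream_next; [|lia|lia].
  by rewrite -addnS stream_next // eval_next succK -addnS.
- apply: bounded_counter bd' _.
  by rewrite /bitlen trunc_log0 muln_gt0 expn_gt0 B_gt0.
- exact: tape_bounded.
- by rewrite size_stream /=; nia.
Qed.

Definition results (s : track) : seq int :=
  [:: Num.min (dsgn s * big s) (dsgn s * sml s); denom s;
      Num.max (dsgn s * big s) (dsgn s * sml s); denom s].

(** With [r] rows left, the next cell to read is the superdiagonal one of row
    [n - r - 1]. *)
Lemma run_rows : (0 < n)%N ->
  reaches (State (regs n n 0 track0 (0, 0, 0)) (stream 0) [::])
    (Seq (block first_ops) (While 3 next_row))
    (State (regs n 0 0 (tracks n) (0, 0, 0)) (stream (n * n)) [::])
    (T + (n.-1 * (T + ((n.-2 * (T + 2 ^ L * B) + (2 ^ L * B).+1) + T) + B) + B.+1)).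
Proof.
move=> n0.
have n1 : (n.-1 < n)%N by rewrite prednK.
pose s_ r := State (regs n r%:Z 0 (tracks (n - r)) (0, 0, 0))
   (stream ((n - r.+1) * n + (n - r))) [::].
apply: (@reaches_seq _ (s_ n.-1)).
  have -> : s_ n.-1 = State (regs n n.-1%:Z 0 (tracks 1) (0, 0, 0)) (stream 1) [::].
    by rewrite /s_ prednK // subnn (_ : n - n.-1 = 1)%N //; lia.
  apply: block_cost => //.
  - rewrite (stream_next n0 n0) eval_first (_ : n%:Z - 1 = n.-1%:Z) //.
    by rewrite -[in LHS](prednK n0) succK.
  - by apply: bounded_wide; apply: (@bounded_regs n n 0 0).
  - exact: tape_bounded.
  - by rewrite size_stream /=; nia.
have -> : State (regs n 0 0 (tracks n) (0, 0, 0)) (stream (n * n)) [::] = s_ 0.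
  rewrite /s_ subn0 subn1; congr (State _ (stream _) _).
  by rewrite -{1}(prednK n0) mulSn addnC.
apply: reaches_while => r rn.
  have [k kE] : exists k, (n - r.+1 = k.+1)%N by exists (n - r.+2)%N; lia.
  have kE' : (n - r = k.+2)%N by lia.
  have kE2 : (n - r.+2 = k)%N by lia.
  by rewrite /s_ kE kE' kE2; apply: run_next_row; lia.
split=> //; have bd : bounded B (vals (s_ r)) by apply: bounded_regs; lia.
exact: (bd 3).
Qed.

Lemma run_all_rows :
  reaches (State (regs n n 0 track0 (0, 0, 0)) (stream 0) [::])
    (While 3 (Seq (block first_ops) (While 3 next_row)))
    (State (regs n 0 0 (tracks n) (0, 0, 0)) (stream (n * n)) [::])
    (T + (n.-1 * (T + ((n.-2 * (T + 2 ^ L * B) + (2 ^ L * B).+1) + T) + B) + B.+1)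
     + B + B.+1).
Proof.
have bd : bounded B (regs n n 0 track0 (0, 0, 0)) by apply: (@bounded_regs n n 0 0).
have [n0|n0] := posnP n.
  pose s_ (_ : nat) := State (regs n n 0 track0 (0, 0, 0)) (stream 0) [::].
  have -> : State (regs n 0 0 (tracks n) (0, 0, 0)) (stream (n * n)) [::] = s_ 0.
    by rewrite /s_ n0.
  apply: (@reaches_leq _ _ _ (0 * (0 + B) + B.+1)); first by lia.
  apply: (@reaches_while _ _ s_ _ _ 0) => // r; rewrite leqn0 => /eqP->.
  by split; [by [] | rewrite /= n0 | exact: (bd 3)].
pose s_ r := if r is 0
  then State (regs n 0 0 (tracks n) (0, 0, 0)) (stream (n * n)) [::]
  else State (regs n n 0 track0 (0, 0, 0)) (stream 0) [::].
apply: reaches_leq (@reaches_while _ _ s_ B _ 1 _ _); first by rewrite mul1n.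
  by case => [|//] _; apply: run_rows.
case=> [|[|//]] _; first by split=> //=; rewrite /bitlen trunc_log0 B_gt0.
by split; [by [] | rewrite /= ltz_nat n0 | exact: (bd 3)].
Qed.

Lemma run_det_program : exists2 s,
  reaches (State [::] (n%:Z :: stream 0) [::]) det_program s
     (30 * (T * input_size ^ 2)) & printed s = results (tracks n).
Proof.
have n0 := input_size_gt0; have nN := dim_small.
have W0 : (0 < 2 ^ L)%N by rewrite expn_gt0.
have BT : (2 ^ L * B <= T)%N.
  rewrite /T; apply: (@leq_trans (1 * (1 * (2 ^ L * B) ^ 1))); first by rewrite expn1; lia.
  rewrite leq_mul //; first by lia.
  rewrite leq_mul //; apply: (@leq_trans ((2 ^ L * (2 ^ L * B)) ^ 1)).
    by rewrite leq_exp2r // leq_pmull.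
  by rewrite leq_pexp2l // muln_gt0 W0 muln_gt0 W0 B_gt0.
have BW : (B <= 2 ^ L * B)%N by rewrite leq_pmull.
have B0 := B_gt0.
have bd : bounded B (regs n 0 0 (tracks n) (0, 0, 0)).
  exact: (@bounded_regs n 0 0 n).
pose f := (eval final_ops (regs n 0 0 (tracks n) (0, 0, 0), stream (n * n))).1.
have bf : bounded (2 ^ L * B) f.
  move=> i; apply: (@leq_trans (2 ^ 4 * B)).
    by apply: (@bounded_eval final_ops) => // z; apply: tape_bounded.
  by rewrite leq_mul2r leq_exp2l ?(leq_trans _ long_enough) ?orbT.
exists (State f (stream (n * n)) (results (tracks n))) => //.
apply: (@reaches_leq _ _ _ (1 + (T + (
  (T + (n.-1 * (T + ((n.-2 * (T + 2 ^ L * B) + (2 ^ L * B).+1) + T) + B) + B.+1)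
     + B + B.+1) + (T + 4 * (2 ^ L * B)))))).
  exact: cost_bound.
apply: reaches_seq; first exact: reaches_const.
apply: (@reaches_seq _ (State (regs n n 0 track0 (0, 0, 0)) (stream 0) [::])).
  apply: block_cost => //.
  - by rewrite [LHS]eval_init subr0.
  - by case=> [|[|r]] //=; rewrite ?nth_nil muln_gt0 W0 B0.
  - move=> z; rewrite in_cons => /predU1P[->|]; last exact: tape_bounded.
    exact: bitlen_small.
apply: reaches_seq run_all_rows _.
apply: (@reaches_seq _ (State f (stream (n * n)) [::])).
  apply: block_cost => //.
  - exact: bounded_wide.
  - exact: tape_bounded.
rewrite (_ : 4 * (2 ^ L * B)
  = 2 ^ L * B + (2 ^ L * B + (2 ^ L * B + 2 ^ L * B)))%N; last by lia.
rewrite /results.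
have print i o : reaches (State f (stream (n * n)) o) (Do (Print i))
    (State f (stream (n * n)) (rcons o f`_i)) (2 ^ L * B).
  exact: reaches_leq (bf i) (@reaches_print _ _ _ _).
exact: reaches_seq (print 17 _) (reaches_seq (print 11 _)
  (reaches_seq (print 18 _) (print 11 _))).
Qed.

End Run.

Lemma cost_polynomial L N :
  (30 * (L * (17 * (2 ^ L * (2 ^ L * (8 * N ^ 2))) ^ 2) * N ^ 2)
   = 30 * (L * (17 * (2 ^ L * (2 ^ L * 8)) ^ 2)) * N ^ 6)%N.
Proof.
by rewrite !expnMn -expnM -[6%N]/(2 * 2 + 2)%N expnD; ring.
Qed.

(** The exponent 6 is made of [T], which is quadratic in the register length
    [8 N ^ 2], and of the at most [N ^ 2] cells. *)
Theorem det_program_polynomial : exists c, forall n C, exists t,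
  [/\ run (compile 0 det_program) (start (n%:Z :: stream n C 0)) t
        (results (tracks C n))
    & (t <= c * bitsize (n%:Z :: stream n C 0) ^ 6)%N].
Proof.
(* Hiding the numeral keeps 2 ^ 100 from being computed. *)
have [L hL] : exists L, (100 <= L)%N by exists 100%N.
exists (30 * (L * (17 * (2 ^ L * (2 ^ L * 8)) ^ 2)))%N => n C.
have [s /reaches_run[t tT r] <-] := run_det_program n C hL.
by exists t; split => //; rewrite -cost_polynomial.
Qed.

(** * The registers hold scaled continuants *)

(** The same recursion built from the top, as the program performs it. *)
Fixpoint forward (R : realFieldType) (a p : nat -> R) k : R * R :=
  if k is k'.+1 then
    let s := forward a p k' in (a k' * s.1 - p k' * s.2, s.1)
  else (1, 0).

Lemma forward_continuant (R : realFieldType) (a p : nat -> R) n :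
  (forward a p n).1 = continuant a p 0 n 1 0.
Proof.
have H m k : continuant a p k m (forward a p k).1 (forward a p k).2
    = (forward a p (k + m)).1.
  by elim: m k => [|m IH] k; rewrite ?addn0 // addnS -addSn -IH.
by rewrite -(H n 0%N).
Qed.

Section Represent.
Variable R : realType.
Local Notation "x %:r" := (x%:~R : R) (at level 2, format "x %:r").

Definition represents (t : triple) (x1 x2 : R) : Prop :=
  [/\ 0 < t.2, t.1.1%:r = t.2%:r * x1 & t.1.2%:r = t.2%:r * x2].

Definition tracked (s : track) (X Y : R * R) : Prop :=
  [/\ 0 < denom s, (big s)%:r = (denom s)%:r * X.1, (big' s)%:r = (denom s)%:r * X.2,
      (sml s)%:r = (denom s)%:r * Y.1 & (sml' s)%:r = (denom s)%:r * Y.2].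

Lemma intr_max (x y : int) : (Num.max x y)%:r = Num.max x%:r y%:r.
Proof.
by case: (leP x y) => xy; [rewrite max_r ?ler_int | rewrite max_l ?ler_int ?ltW].
Qed.

Lemma intr_min (x y : int) : (Num.min x y)%:r = Num.min x%:r y%:r.
Proof.
by case: (leP x y) => xy; [rewrite min_l ?ler_int | rewrite min_r ?ler_int ?ltW].
Qed.

Lemma clampE (x : int) : clamp x = Num.sg x.
Proof.
rewrite /clamp; case: sgrP => [->|x0|x0] //;
  by rewrite /Num.min /Num.max; do ?case: ifP; lia.
Qed.

Lemma scale_represents g t x1 x2 : represents t x1 x2 ->
  represents (scale g t) (g%:r * x1) (g%:r * x2).
Proof.
by move=> [t0 e1 e2]; split; rewrite //= intrM ?e1 ?e2 mulrC mulrCA.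
Qed.

Lemma clamp_represents t x1 x2 : represents t x1 x2 -> (clamp t.1.1)%:r = Num.sg x1.
Proof.
case=> t0 e1 _; rewrite clampE intr_sg e1 sgrM (gtr0_sg (_ : 0 < t.2%:r)) ?mul1r //.
by rewrite ltr0z.
Qed.

(** Clearing denominators in one step of the two recursions: maxima and minima
    commute with the multiplication by the positive common denominator. *)
Lemma row_tracked g b c a s b1 b2 c1 c2 a1 a2 X Y : g = Num.sg a1 ->
  represents b b1 b2 -> represents c c1 c2 -> represents a a1 a2 ->
  tracked s X Y ->
  tracked (absorb_row b c a s)
    (Num.max (g * a1) (g * a2) * X.1
      - min4 (b1 * (g * c1)) (b1 * (g * c2)) (b2 * (g * c1)) (b2 * (g * c2)) * X.2, X.1)
    (Num.min (g * a1) (g * a2) * Y.1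
      - max4 (b1 * (g * c1)) (b1 * (g * c2)) (b2 * (g * c1)) (b2 * (g * c2)) * Y.2, Y.1).
Proof.
move=> gE bR cR aR [E0 S S' T T'].
have {}gE : (clamp a.1.1)%:r = g by rewrite gE (clamp_represents aR).
have := scale_represents (clamp a.1.1) aR; rewrite gE => -[/= a0 ea1 ea2].
have := scale_represents (clamp a.1.1) cR; rewrite gE => -[/= c0 ec1 ec2].
have [b0 eb1 eb2] := bR.
have d0 : 0 <= b.2%:r * c.2%:r by rewrite mulr_ge0 // ler0z ltW.
have a0' : 0 <= a.2%:r by rewrite ler0z ltW.
have prod (u v : int) (x y : R) : u%:r = b.2%:r * x -> v%:r = c.2%:r * y ->
    (u * v)%:r = b.2%:r * c.2%:r * (x * y).
  by move=> eu ev; rewrite intrM eu ev mulrACA.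
have hM : (Num.max (a.1.1 * clamp a.1.1) (a.1.2 * clamp a.1.1))%:r
    = a.2%:r * Num.max (g * a1) (g * a2) by rewrite intr_max ea1 ea2 maxr_pMr.
have hm : (Num.min (a.1.1 * clamp a.1.1) (a.1.2 * clamp a.1.1))%:r
    = a.2%:r * Num.min (g * a1) (g * a2) by rewrite intr_min ea1 ea2 minr_pMr.
have p11 := prod _ _ _ _ eb1 ec1; have p12 := prod _ _ _ _ eb1 ec2.
have p21 := prod _ _ _ _ eb2 ec1; have p22 := prod _ _ _ _ eb2 ec2.
split; rewrite /= ?mulr_gt0 // ?rmorphB /= !intrM.
- by rewrite hM /min4 !intr_min p11 p12 p21 p22 -!(minr_pMr _ _ d0) S S'; ring.
- by rewrite S; ring.
- by rewrite hm /max4 !intr_max p11 p12 p21 p22 -!(maxr_pMr _ _ d0) T T'; ring.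
- by rewrite T; ring.
Qed.

End Represent.

(** * Correctness of the registers *)

Definition qfrac0 : qfrac := QFrac 0 (ltr01 : 0 < 1 :> int).

Definition cells (M : rat_interval_mx) (i j : nat) : qfrac * qfrac :=
  if (insub i, insub j) is (Some i', Some j') then (lower M i' j', upper M i' j')
  else (qfrac0, qfrac0).

Section Correct.
Variables (R : realType) (M : rat_interval_mx).
Local Notation "x %:r" := (x%:~R : R) (at level 2, format "x %:r").
Let n := Defs.dim M.
Let lo := lower_mx R M.
Let hi := upper_mx R M.
Let C := cells M.

Lemma common_represents i j :
  represents (common (C i j)) (entry lo i j) (entry hi i j).
Proof.
have fracE (f h : qfrac) : represents (common (f, h)) (qfrac_val R f) (qfrac_val R h).
  have f0 : (qden f)%:r != 0 by rewrite intr_eq0 gt_eqF ?qden_gt0.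
  have h0 : (qden h)%:r != 0 by rewrite intr_eq0 gt_eqF ?qden_gt0.
  split; rewrite /= ?mulr_gt0 ?qden_gt0 // !intrM /qfrac_val.
    by field.
  by field.
rewrite /C /cells /entry /lo /hi; case: insubP => [i' _ _|_]; last first.
  by split; rewrite ?mulr0 ?mulr1 //= ?mul0r.
case: insubP => [j' _ _|_]; first by rewrite !mxE.
by split; rewrite ?mulr0 ?mulr1 //= ?mul0r.
Qed.

Hypothesis inst : tridiagonal_Hmatrix_instance R M.

Lemma tracks_correct k : let s := tracks C k in
  [/\ tracked s (forward (diag_max lo hi) (link_min lo hi) k)
        (forward (diag_min lo hi) (link_max lo hi) k),
      (dsgn s)%:r = \prod_(i < k) row_sign lo i
    & (0 < k)%N -> (rsgn s)%:r = row_sign lo k.-1].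
Proof.
elim: k => [|k [IHt IHd IHr]] s.
  by split; rewrite ?big_ord0 //; split; rewrite /= ?mulr1 ?mulr0.
have cR := common_represents.
have cl := clamp_represents (cR k k).
have dE : dsgn s = dsgn (tracks C k) * clamp (common (C k k)).1.1 by rewrite /s; case: (k).
have rE : rsgn s = clamp (common (C k k)).1.1 by rewrite /s; case: (k).
split; [|by rewrite dE intrM cl IHd big_ord_recr|by rewrite rE cl].
clear dE rE cl IHd; rewrite /s; clear s; case: k IHt IHr => [|k] IHt IHr.
  have z : represents (0, 0, 1) (0 : R) 0 by split; rewrite /= ?mulr0.
  have := row_tracked erefl z z (cR 0%N 0%N) IHt.
  by rewrite /= !mulr0.
have := scale_represents (rsgn (tracks C k.+1)) (cR k k.+1).
by rewrite IHr // => bR; apply: row_tracked erefl bR (cR k.+1 k) (cR k.+1 k.+1) IHt.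
Qed.

(** The two terms are exact bounds for the scaled determinant; multiplying them by
    the product [dsgn] of the row signs yields bounds for the determinant, to be
    exchanged if it is -1. *)
Lemma results_correct : det_bounds R M (results (tracks C n)).
Proof.
have [le_lo_hi tri H] := inst.
have [[E0 S _ T _] dG _] := tracks_correct n.
have [] := sdet_extrema le_lo_hi tri H.
rewrite -!forward_continuant -/n -dG.
move: S T; set X := (forward _ _ _).1; set Y := (forward _ _ _).1 => S T maxA minA bd.
set s := tracks C n in E0 S T dG maxA minA bd *.
have E0' : (denom s)%:r != 0 by rewrite intr_eq0 gt_eqF.
exists (QFrac (Num.min (dsgn s * big s) (dsgn s * sml s)) E0).
exists (QFrac (Num.max (dsgn s * big s) (dsgn s * sml s)) E0).
have val (m : int) (z : R) : m%:r = (denom s)%:r * z ->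
    qfrac_val R (QFrac m E0) = z.
  by move=> e; rewrite /qfrac_val /= e mulrAC divff // mul1r.
have YX : Y <= X.
  by have [A AI _] := maxA; have [YA AX] := bd A AI; apply: le_trans AX.
have normG : `|(dsgn s)%:r| = 1.
  rewrite dG normr_prod big1 // => i _; exact: (row_sign_norm le_lo_hi H).
have eS : (dsgn s * big s)%:r = (denom s)%:r * ((dsgn s)%:r * X).
  by rewrite intrM S mulrCA.
have eT : (dsgn s * sml s)%:r = (denom s)%:r * ((dsgn s)%:r * Y).
  by rewrite intrM T mulrCA.
have [Amax AmaxI eX] := maxA; have [Amin AminI eY] := minA.
have d0 : 0 <= (denom s)%:r by rewrite ler0z ltW.
have fmin : qfrac_val R (QFrac (Num.min (dsgn s * big s) (dsgn s * sml s)) E0)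
    = Num.min ((dsgn s)%:r * X) ((dsgn s)%:r * Y).
  by apply: val; rewrite intr_min eS eT minr_pMr.
have fmax : qfrac_val R (QFrac (Num.max (dsgn s * big s) (dsgn s * sml s)) E0)
    = Num.max ((dsgn s)%:r * X) ((dsgn s)%:r * Y).
  by apply: val; rewrite intr_max eS eT maxr_pMr.
move: normG eX eY bd; rewrite fmin fmax; move: (dsgn s)%:r => d normd eX eY bd.
have [d1|d1] : d = 1 \/ d = -1.
- case: (lerP 0 d) => dge0; first by left; move: normd; rewrite ger0_norm.
  by right; move: normd; rewrite ltr0_norm // => e; rewrite -[LHS]opprK e.
- have [emin emax] : Num.min (d * X) (d * Y) = Y /\ Num.max (d * X) (d * Y) = X.
    by rewrite d1 !mul1r min_r // max_l.
  rewrite emin emax; rewrite d1 !mul1r in eX eY; split=> //; split.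
  + by exists Amin.
  + by move=> _ [A AI <-]; have := bd A AI; rewrite d1 mul1r => -[].
  + by exists Amax.
  + by move=> _ [A AI <-]; have := bd A AI; rewrite d1 mul1r => -[].
- have [emin emax] : Num.min (d * X) (d * Y) = - X /\ Num.max (d * X) (d * Y) = - Y.
    by rewrite d1 !mulN1r min_l ?max_r // lerN2.
  rewrite emin emax; rewrite d1 !mulN1r in eX eY; split=> //; split.
  + by exists Amax => //; rewrite -eX opprK.
  + move=> _ [A AI <-]; have := bd A AI; rewrite d1 mulN1r => -[_].
    by rewrite lerNl.
  + by exists Amin => //; rewrite -eY opprK.
  + move=> _ [A AI <-]; have := bd A AI; rewrite d1 mulN1r => -[+ _].
    by rewrite lerNr.
Qed.

End Correct.

Lemma map_iota_mul (T : Type) (F : nat -> nat -> T) n m :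
  [seq F (p %/ n)%N (p %% n)%N | p <- iota 0 (m * n)]
  = flatten [seq [seq F i j | j <- iota 0 n] | i <- iota 0 m].
Proof.
elim: m => [|m IH]; first by rewrite mul0n.
rewrite mulSnr iotaD map_cat IH -addn1 iotaD map_cat flatten_cat /= cats0 add0n.
congr (_ ++ _); rewrite add0n -[(m * n)%N]addn0 iotaDl -map_comp; apply/eq_in_map => j.
rewrite mem_iota add0n => /andP[_ jn] /=.
by rewrite divnMDl ?divn_small ?addn0 ?modnMDl ?modn_small //; lia.
Qed.

Lemma code_stream M :
  rat_interval_mx_code M = (Defs.dim M)%:Z :: stream (Defs.dim M) (cells M) 0.
Proof.
rewrite /rat_interval_mx_code /stream subn0; congr (_ :: flatten _).
rewrite (map_iota_mul (fun i j => interval_code (cells M i j))).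
rewrite -val_enum_ord -map_comp; congr flatten; apply: eq_map => i /=.
by rewrite -map_comp; apply: eq_map => j; rewrite /= /cells !valK.
Qed.

Theorem proposition6p7 (R : realType) :
  polytime_solvable rat_interval_mx_code
    (tridiagonal_Hmatrix_instance R) (det_bounds R).
Proof.
have [c Hc] := det_program_polynomial.
exists (compile 0 det_program), c, 6%N => M inst; rewrite code_stream.
have [t [r tc]] := Hc (Defs.dim M) (cells M).
exists t, (results (tracks (cells M) (Defs.dim M))); split => //.
exact: results_correct.
Qed.
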